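(* Let $T$ be a positive integer. Then the three-state toric homogeneous Markov $T$-chain ideal $I_{3,T}$ has Markov degree two.
   Context: Let $\mathbb{K}$ be a field. For positive integers $S,T$ let $[S]=\{1,\dots,S\}$ and let $R_{S,T}=\mathbb{K}[x_w \mid w=i_1\ldots i_T \text{ a } T\text{-letter word on the alphabet } [S] \text{ with } i_j\neq i_{j+1}]$ be the polynomial ring with one variable for each such word. The $S$-state toric homogeneous Markov $T$-chain ideal $I_{S,T}\subseteq R_{S,T}$ is the kernel of the ring homomorphism $\Phi_{S,T}:R_{S,T}\to R_{S,2}$ given by $\Phi_{S,T}(x_{i_1\ldots i_T})=x_{i_1i_2}x_{i_2i_3}\cdots x_{i_{T-1}i_T}$. The Markov degree of an ideal is the smallest degree of a generating set, where the degree of a generating set is the highest degree of an element in it.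
   Formalization: For T = 1 (kernel generated by the x_i − 1, Markov degree 1) and T = 2 (zero ideal) the Markov degree is not two; the formal statement proves that it is exactly two for every T ≥ 3 and that it exists and is at most two for every positive T. *)

(* Defs.v *)
From HB Require Import structures.
From mathcomp Require Import all_boot all_order all_algebra.
From mathcomp Require Import mpoly.

Set Implicit Arguments.
Unset Strict Implicit.
Unset Printing Implicit Defensive.

Import GRing.Theory.

Local Open Scope ring_scope.

Record word (S T : nat) := Word {
  letters :> T.-tuple 'I_S;
  _ : sorted [rel i j | i != j] letters
}.

HB.instance Definition _ S T := [isSub for @letters S T].
HB.instance Definition _ S T := [Finite of word S T by <:].

(* mpoly indexes variables by ordinals, so the words are numbered by their
   rank in the enumeration of the finite type [word S T]. *)
Definition word_ring (K : fieldType) (S T : nat) : comNzRingType :=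
  {mpoly K[#|{: word S T}|]}.

Definition word_var (K : fieldType) (S T : nat) (w : word S T) :
    word_ring K S T :=
  'X_(enum_rank w).

Lemma ltn_ord_pred (T : nat) (j : 'I_T.-1) : (j < T)%N.
Proof. exact: leq_trans (ltn_ord j) (leq_pred T). Qed.

Lemma ltn_ordS_pred (T : nat) (j : 'I_T.-1) : (j.+1 < T)%N.
Proof. by rewrite -ltn_predRL. Qed.

Definition step_letters (S T : nat) (w : word S T) (j : 'I_T.-1) :
    2.-tuple 'I_S :=
  [tuple tnth w (Ordinal (ltn_ord_pred j));
         tnth w (Ordinal (ltn_ordS_pred j))].

Lemma step_lettersP (S T : nat) (w : word S T) (j : 'I_T.-1) :
  sorted [rel i k | i != k] (step_letters w j).
Proof.
case: w => w sorted_w /=; rewrite andbT.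
pose x0 := tnth w (Ordinal (ltn_ord_pred j)).
rewrite !(tnth_nth x0) /=.
by apply: (sortedP x0 sorted_w); rewrite size_tuple ltn_ordS_pred.
Qed.

Definition step (S T : nat) (w : word S T) (j : 'I_T.-1) : word S 2 :=
  Word (step_lettersP w j).

Definition Phi (K : fieldType) (S T : nat) (p : word_ring K S T) :
    word_ring K S 2 :=
  mmap (@mpolyC _ K)
    (fun i => \prod_(j < T.-1) word_var K (step (enum_val i) j)) p.

Definition markov_chain_ideal (K : fieldType) (S T : nat)
    (p : word_ring K S T) : Prop :=
  Phi p = 0.

Definition generated_ideal (R : comNzRingType) (G : R -> Prop) (p : R) : Prop :=
  exists (n : nat) (a g : 'I_n -> R),
    (forall i, G (g i)) /\ p = \sum_(i < n) a i * g i.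

Definition generates (R : comNzRingType) (G I : R -> Prop) : Prop :=
  forall p, I p <-> generated_ideal G p.

(* The zero polynomial has degree 0 here. *)
Definition mpoly_degree (K : fieldType) (n : nat) (p : {mpoly K[n]}) : nat :=
  (msize p).-1.

Definition set_degree (K : fieldType) (n : nat) (G : {mpoly K[n]} -> Prop)
    (d : nat) : Prop :=
  (forall g, G g -> (mpoly_degree g <= d)%N) /\
  (exists2 g, G g & mpoly_degree g = d).

Definition markov_degree (K : fieldType) (n : nat) (I : {mpoly K[n]} -> Prop)
    (d : nat) : Prop :=
  (exists2 G, generates G I & set_degree G d) /\
  (forall G e, generates G I -> set_degree G e -> (d <= e)%N).

(* Main.v *)
Require Import Defs.
From mathcomp Require Import all_boot all_order all_algebra.
From mathcomp Require Import mpoly.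
From mathcomp Require Import zify.
From Stdlib Require Import Classical.

Set Implicit Arguments.
Unset Strict Implicit.
Unset Printing Implicit Defensive.

Import Order.TTheory GRing.Theory Num.Theory.

Local Open Scope ring_scope.

(**
A word is a walk on a triangle, and its image under [Phi] only records how
often each of the six arcs is used.  Encode these six numbers by a profile
(d, m): for each edge of the triangle, d is the number of traversals in the
cyclic direction minus those against it (the flow), and m the number of
traversals that cancel (the loops).  Any two edges of a triangle meet, so an
Eulerian path exists as soon as the degrees allow it, and the profiles of walks
with N steps are exactly the (d, m) such that the entries of d differ pairwise by
at most one, m is nonnegative, and |sum d| + 2 sum m = N ([profile_of_word_valid],
[profile_of_word_surj]).  Thus d ranges over the points of a fixed parity in a
hexagonal prism around the diagonal of Z^3, and m is a free vector.

The ideal is spanned by binomials that compare two families of words with the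
same image.  It is therefore generated in degree two as soon as any two such
families are connected by moves that replace two words by two words with the
same joint image ([ideal_of_fibers]).  This is [connected], in three steps.

- For prescribed flows, loops can be passed from word to word one unit at a time
  ([align]).
- Let the height of a flow be the sum of its entries.  Two flows whose heights
  differ by four or more can be replaced by two flows of intermediate heights,
  unless they are less than eight apart and lie on a common facet of the prism
  ([improve]).  Such moves ask for no additional loops, and they lower the sum of
  the squared heights, so that one reaches a stable family, to which none applies
  ([descend]).
- The flows of a stable family lie in one cell of a subdivision of the prism into
  tetrahedra and octahedra: some affine function stays below the squared height on
  the whole prism and touches it exactly at the vertices of that cell
  ([stable_supports]).  So stable families minimise the energy for their total,
  and two of them with the same total lie in the same cell ([stable_unique]).
  In a tetrahedron the total determines the family.  In an octahedron two families
  differ by trading pairs of antipodal vertices, which are again moves on two words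
  ([octahedron_connected]).

For the lower bound, take two words that alternate between a common state and
two different other states, and let them exchange their tails.  The quadratic
binomial obtained in this way does not vanish at a point where every element of
degree at most one of the ideal vanishes ([linear_eval],
[generators_degree_gt1]).
*)

(** * Flow vectors in the prism *)

Definition v0 : 'I_3 := @Ordinal 3 0 isT.
Definition v1 : 'I_3 := @Ordinal 3 1 isT.
Definition v2 : 'I_3 := @Ordinal 3 2 isT.

Lemma forall_I3 (P : 'I_3 -> Prop) : P v0 -> P v1 -> P v2 -> forall i, P i.
Proof.
move=> p0 p1 p2 [[|[|[|//]]] lti].
- by rewrite (_ : Ordinal lti = v0) //; apply: val_inj.
- by rewrite (_ : Ordinal lti = v1) //; apply: val_inj.
- by rewrite (_ : Ordinal lti = v2) //; apply: val_inj.
Qed.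

Definition vec := (int * int * int)%type.

Definition entry (d : vec) (i : 'I_3) : int :=
  match val i with 0%N => d.1.1 | 1%N => d.1.2 | _ => d.2 end.

Definition vec_of (f : 'I_3 -> int) : vec := (f v0, f v1, f v2).

Lemma entry_vec_of f i : entry (vec_of f) i = f i.
Proof. by move: i; apply: forall_I3. Qed.

Lemma vec_ext (d e : vec) : entry d =1 entry e -> d = e.
Proof.
case: d e => [[? ?] ?] [[? ?] ?] h.
by congr (_, _, _); [apply: (h v0) | apply: (h v1) | apply: (h v2)].
Qed.

(** For the flow of a walk this is the signed number of steps around the
    triangle. It is the position along the axis of the prism of balanced
    vectors. *)
Definition height (d : vec) : int := entry d v0 + entry d v1 + entry d v2.

Definition balanced (d : vec) : bool :=
  [forall i, forall j, entry d i - entry d j <= 1].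

Lemma balancedP d : reflect (forall i j, entry d i - entry d j <= 1) (balanced d).
Proof. by apply: (iffP 'forall_forallP). Qed.

Lemma balancedE d : balanced d =
  [&& `|entry d v0 - entry d v1| <= 1, `|entry d v1 - entry d v2| <= 1
    & `|entry d v2 - entry d v0| <= 1].
Proof.
apply/balancedP/idP => [h|h].
  move: (h v0 v1) (h v1 v0) (h v0 v2) (h v2 v0) (h v1 v2) (h v2 v1); lia.
by apply: forall_I3; apply: forall_I3; move: h; lia.
Qed.

(** The prism is a stack of layers: one point on the axis, then two
    triangles. *)
Variant balanced_spec : vec -> Prop :=
  | BalO k : balanced_spec (k, k, k)
  | BalP0 k : balanced_spec (k + 1, k, k)
  | BalP1 k : balanced_spec (k, k + 1, k)
  | BalP2 k : balanced_spec (k, k, k + 1)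
  | BalN0 k : balanced_spec (k, k + 1, k + 1)
  | BalN1 k : balanced_spec (k + 1, k, k + 1)
  | BalN2 k : balanced_spec (k + 1, k + 1, k).

Lemma balanced_cases d : balanced d -> balanced_spec d.
Proof.
case: d => [[a b] c]; rewrite balancedE /entry /= => h.
have [m hm] : exists m : int, m <= a <= m + 1 /\ m <= b <= m + 1 /\ m <= c <= m + 1
  /\ (a = m \/ b = m \/ c = m).
  by exists (Num.min a (Num.min b c)); lia.
case: hm => ha [hb [hc hm]].
have [->|->] : a = m \/ a = m + 1 by lia.
all: have [->|->] : b = m \/ b = m + 1 by lia.
all: have [->|->] : c = m \/ c = m + 1 by lia.
all: try by constructor.
Qed.

(** Equivalently, both vectors lie on a facet x_i - x_j = 1 of the prism. Two
    vectors with this sum can only be replaced by vectors of the same facet,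
    which may leave no room between them. *)
Definition locked (d e : vec) : bool :=
  [exists i, exists j,
     (entry d i - entry d j == 1) && (entry e i - entry e j == 1)].

(** The pairs that can be replaced by two balanced vectors with the same sum
    and intermediate heights, when all heights have one parity. Heights at
    least 8 apart leave room for a shift by 2 of all entries, which has no
    effect on their differences. *)
Definition improvable (d e : vec) : bool :=
  (height d + 8 <= height e) || (height d + 4 <= height e) && ~~ locked d e.

Lemma lockedE d e : locked d e =
  [|| (entry d v0 - entry d v1 == 1) && (entry e v0 - entry e v1 == 1),
   (entry d v1 - entry d v0 == 1) && (entry e v1 - entry e v0 == 1),
   (entry d v0 - entry d v2 == 1) && (entry e v0 - entry e v2 == 1),
   (entry d v2 - entry d v0 == 1) && (entry e v2 - entry e v0 == 1),
   (entry d v1 - entry d v2 == 1) && (entry e v1 - entry e v2 == 1)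
 | (entry d v2 - entry d v1 == 1) && (entry e v2 - entry e v1 == 1)].
Proof.
apply/existsP/idP => [[i /existsP [j]]|].
  by move: i j; apply: forall_I3; apply: forall_I3;
    rewrite ?subrr => /andP[] // -> -> /=;
     rewrite ?orbT.
case/or4P => [h|h|h|/or3P[h|h|h]].
- by exists v0; apply/existsP; exists v1.
- by exists v1; apply/existsP; exists v0.
- by exists v0; apply/existsP; exists v2.
- by exists v2; apply/existsP; exists v0.
- by exists v1; apply/existsP; exists v2.
- by exists v2; apply/existsP; exists v1.
Qed.

(** With loops m, the number of steps against the cyclic direction is [neg d i]
    plus the entry of m. *)
Definition neg (d : vec) (i : 'I_3) : int := Num.max (- entry d i) 0.

(** The function x |-> max(-x, 0) is convex, so moving two arguments towards
    each other does not increase its sum. *)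
Lemma convex_neg (p q x y : int) : p <= x -> p <= y -> x + y = p + q ->
  Num.max (- x) 0 + Num.max (- y) 0 <= Num.max (- p) 0 + Num.max (- q) 0.
Proof. lia. Qed.

(** The height changes by 2 s, and for s = 1 or s = -1 this is the least change
    that respects parity. *)
Definition shift (s : int) (l : 'I_3) (d : vec) : vec :=
  vec_of (fun i => entry d i + s * (i != l)%:Z).

Lemma unlocked_shift d e : balanced d -> balanced e ->
  height d + 4 <= height e <= height d + 6 -> ~~ locked d e ->
  exists l, balanced (shift 1 l d) && balanced (shift (- 1) l e).
Proof.
move=> bd be hh nl.
suff: [|| balanced (shift 1 v0 d) && balanced (shift (- 1) v0 e),
          balanced (shift 1 v1 d) && balanced (shift (- 1) v1 e)
        | balanced (shift 1 v2 d) && balanced (shift (- 1) v2 e)].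
  by case/or3P => ?; [exists v0 | exists v1 | exists v2].
move: hh nl; rewrite lockedE !balancedE /height !entry_vec_of /=.
case: {bd} d / (balanced_cases bd) => k1;
  case: {be} e / (balanced_cases be) => k2; rewrite /entry /=; lia.
Qed.

(** The bound on [neg] is what makes the move usable for walks: the two new
    flows need at most as many steps against the cyclic direction as the old
    ones, so that the loops already present suffice. *)
Lemma improve (d e : vec) (k : int) :
  balanced d -> balanced e -> improvable d e -> height e = height d + 2 * k ->
  exists d' e' k', [/\ balanced d' /\ balanced e',
     forall i, entry d' i + entry e' i = entry d i + entry e i,
     forall i, neg d' i + neg e' i <= neg d i + neg e i,
     height d' = height d + 2 * k' & 0 < k' < k].
Proof.
move=> bd be imp hk.
have [big|small] := boolP (height d + 8 <= height e).
  (* A shift along the axis keeps the differences of entries. *)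
  exists (vec_of (fun i => entry d i + 2)), (vec_of (fun i => entry e i - 2)), 3.
  move: bd be hk big {imp}; rewrite !balancedE /height !entry_vec_of => bd be hk
    big.
  split; [split| | | |]; try lia.
  - by move=> i; rewrite !entry_vec_of; lia.
  - move=> i; rewrite /neg !entry_vec_of; apply: convex_neg; [lia| |lia].
    by move: i; apply: forall_I3; lia.
move: imp; rewrite /improvable (negbTE small) /= => /andP [h4 nl].
have hh : height d + 4 <= height e <= height d + 6 by lia.
have [l /andP [bd' be']] := unlocked_shift bd be hh nl.
exists (shift 1 l d), (shift (- 1) l e), 1.
split; [by [] | | | |by lia].
- by move=> i; rewrite !entry_vec_of; lia.
- move=> i; rewrite /neg !entry_vec_of; apply: convex_neg; [lia| |lia].
  move: bd be bd' be' {nl}; rewrite !balancedE.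
  move: h4; rewrite /height; move: i l; apply: forall_I3; apply: forall_I3;
    rewrite !entry_vec_of /=; lia.
- by rewrite /height !entry_vec_of; move: l {bd' be'}; apply: forall_I3 => /=; lia.
Qed.

(** * Affine functions touching the energy from below *)

Definition total (U : seq vec) (i : 'I_3) : int := \sum_(d <- U) entry d i.

Lemma total_cons d U i : total (d :: U) i = entry d i + total U i.
Proof. exact: big_cons. Qed.

Definition same_total (U V : seq vec) : Prop :=
  size U = size V /\ total U =1 total V.

Definition affine (f : vec -> int) : Prop :=
  exists a0 a b c : int, forall d,
    f d = a0 + a * entry d v0 + b * entry d v1 + c * entry d v2.

Lemma affine_sum f U V : affine f -> same_total U V ->
  \sum_(d <- U) f d = \sum_(d <- V) f d.
Proof.
case=> a0 [a [b [c fE]]] [szUV eqUV].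
have E W : \sum_(d <- W) f d =
    a0 * (size W)%:Z + a * total W v0 + b * total W v1 + c * total W v2.
  elim: W => [|d W IH]; first by rewrite /total !big_nil !mulr0 !addr0.
  by rewrite big_cons IH fE !total_cons /=; lia.
by rewrite !E szUV !eqUV.
Qed.

(** Barycentric coordinates: an affine function that vanishes on all vertices
    of a simplex but one counts how often that vertex occurs, and its sum
    depends on the total only. *)
Lemma perm_eq_of_functionals (U V : seq vec) : same_total U V ->
  (forall v, v \in U ++ V -> exists2 f, affine f &
     exists2 m : int, m != 0 & forall d, d \in U ++ V -> f d = m * (d == v)%:Z) ->
  perm_eq U V.
Proof.
move=> eqUV sep; apply/allP => v vUV /=.
have [f aff_f [m m0 fE]] := sep v vUV.
have count_f W : {subset W <= U ++ V} -> \sum_(d <- W) f d = m * (count_mem v W)%:Z.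
  elim: W => [|d W IH] sub; first by rewrite big_nil /= mulr0.
  rewrite big_cons /= IH => [|x xW]; last by apply: sub; rewrite inE xW orbT.
  by rewrite fE ?sub ?mem_head // eq_sym; case: eqP => /=; lia.
have subU : {subset U <= U ++ V} by move=> x xU; rewrite mem_cat xU.
have subV : {subset V <= U ++ V} by move=> x xV; rewrite mem_cat xV orbT.
have := affine_sum aff_f eqUV; rewrite (count_f U subU) (count_f V subV).
by move=> /(mulfI m0) [->].
Qed.

Definition parity (p : int) (d : vec) := exists k, height d = p + 2 * k.

(** Chords of the square function between consecutive integers. They reduce the
    quadratic inequalities on heights to linear ones. *)
Lemma sq_ge (t m : int) : (2 * m + 1) * t - m * (m + 1) <= t * t.
Proof.
have : 0 <= (t - m) * (t - m - 1); last by lia.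
have [tm|tm] := leP t m; [apply: mulr_le0 | apply: mulr_ge0]; lia.
Qed.

(** The squared height relative to the axis point c(1,1,1), minus an affine
    function. With e_i the unit vectors and r_i = (1,1,1) - e_i, the affine
    function takes the value 0 at the axis point and the value 4 at the axis
    point plus [eps i] r_i. Hence the cell on which the gap vanishes is the
    tetrahedron spanned by these four points. *)
Definition star_gap (c : int) (eps : 'I_3 -> int) (d : vec) : int :=
  let h := height d - 3 * c in
  h * h - (eps v0 * (2 * h - 4 * (entry d v0 - c)) +
           eps v1 * (2 * h - 4 * (entry d v1 - c)) +
           eps v2 * (2 * h - 4 * (entry d v2 - c))).

(** It vanishes on the octahedron of the points c(1,1,1) + e_i and c(1,1,1) -
    e_i, whose relative heights are 1 and -1. *)
Definition octa_gap (c : int) (d : vec) : int :=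
  let h := height d - 3 * c in h * h - 1.

(** For s = 1, relative to c(1,1,1), it vanishes on the tetrahedron with
    vertices -e_i, 2(1,1,1) - e_i and e_j for the two j other than i. The first
    two span an edge parallel to the axis, of height 6, which lies on the
    boundary of the prism. For s = -1 the tetrahedron is reflected in the point
    c(1,1,1). *)
Definition edge_gap (c s : int) (i : 'I_3) (d : vec) : int :=
  let h := height d - 3 * c in h * h - 12 * s * h + 24 * s * (entry d i - c) + 11.

(** Two such functions have the same difference of sums over families with the
    same total, namely the difference of the energies. *)
Definition energetic (gap : vec -> int) :=
  affine (fun d => gap d - height d * height d).

Lemma affineI f a0 a b c :
  (forall d, f d = a0 + a * entry d v0 + b * entry d v1 + c * entry d v2) ->
  affine f.
Proof. by move=> fE; exists a0, a, b, c. Qed.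

Lemma star_gap_energetic c eps : energetic (star_gap c eps).
Proof.
rewrite /energetic /star_gap /height.
(* The linear part of the affine function takes the value s at (1,1,1). *)
pose s := 2 * (eps v0 + eps v1 + eps v2).
apply: (@affineI _ (9 * c * c + c * s)
    (4 * eps v0 - 6 * c - s) (4 * eps v1 - 6 * c - s) (4 * eps v2 - 6 * c - s)).
by move=> d; rewrite /s; lia.
Qed.

Lemma octa_gap_energetic c : energetic (octa_gap c).
Proof.
rewrite /energetic /octa_gap /height.
apply: (@affineI _ (9 * c * c - 1) (- 6 * c) (- 6 * c) (- 6 * c)).
by move=> d; lia.
Qed.

Lemma edge_gap_energetic c s i : energetic (edge_gap c s i).
Proof.
rewrite /energetic /edge_gap /height.
apply: (@affineI _ (9 * c * c + 12 * s * c + 11)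
  (24 * s * (v0 == i)%:Z - 6 * c - 12 * s)
  (24 * s * (v1 == i)%:Z - 6 * c - 12 * s)
  (24 * s * (v2 == i)%:Z - 6 * c - 12 * s)).
by move=> d; move: i; apply: forall_I3 => /=; lia.
Qed.

(** * The gaps are nonnegative and vanish at the vertices of the cells *)

Lemma star_gap_ge0 c eps d : (forall i, `|eps i| = 1) -> parity c d -> balanced d ->
  0 <= star_gap c eps d.
Proof.
move=> eps1 [k + bd]; rewrite /star_gap.
have e0 : eps v0 = 1 \/ eps v0 = - 1 by move: (eps1 v0); lia.
have e1 : eps v1 = 1 \/ eps v1 = - 1 by move: (eps1 v1); lia.
have e2 : eps v2 = 1 \/ eps v2 = - 1 by move: (eps1 v2); lia.
case: {bd} d / (balanced_cases bd) => m; rewrite /height /entry /=;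
(have [t ->] : exists t, m = c + t by exists (m - c); lia);
case: e0 => ->; case: e1 => ->; case: e2 => -> hk;
move: (sq_ge t 0) (sq_ge t 1) (sq_ge t (- 1)) (sq_ge t (- 2)); lia.
Qed.

Lemma octa_gap_ge0 c d : parity (c + 1) d -> 0 <= octa_gap c d.
Proof.
case=> k; rewrite /octa_gap => ->.
have [t ->] : exists t, k = c + t by exists (k - c); lia.
move: (sq_ge t 0) (sq_ge t (- 1)); lia.
Qed.

Lemma edge_gap_ge0 c s i d : `|s| = 1 -> parity (c + 1) d -> balanced d ->
  0 <= edge_gap c s i d.
Proof.
move=> s1 [k + bd]; rewrite /edge_gap.
have {s1} [->|->] : s = 1 \/ s = - 1 by lia.
all: case: {bd} d / (balanced_cases bd) => m; rewrite /height /entry /=;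
(have [t ->] : exists t, m = c + t by exists (m - c); lia);
move=> hk; move: i; apply: forall_I3 => /=;
move: (sq_ge t 0) (sq_ge t 1) (sq_ge t (- 1)) (sq_ge t (- 2)) (sq_ge t 2) (sq_ge t
  (- 3)); lia.
Qed.

Definition cst (c : int) : vec := vec_of (fun=> c).

Lemma star_gap_eq0 c eps d : (forall i, `|eps i| = 1) -> parity c d -> balanced d ->
  star_gap c eps d = 0 ->
  d = cst c \/ exists i, d = shift (eps i) i (cst c).
Proof.
move=> eps1 [k + bd]; rewrite /star_gap.
have e0 : eps v0 = 1 \/ eps v0 = - 1 by move: (eps1 v0); lia.
have e1 : eps v1 = 1 \/ eps v1 = - 1 by move: (eps1 v1); lia.
have e2 : eps v2 = 1 \/ eps v2 = - 1 by move: (eps1 v2); lia.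
move=> hk g0.
suff: [|| d == cst c, d == shift (eps v0) v0 (cst c),
   d == shift (eps v1) v1 (cst c) | d == shift (eps v2) v2 (cst c)].
  by case/or4P => /eqP; [left | right; exists v0| right; exists v1| right;
    exists v2].
move: hk g0; rewrite /shift /cst /vec_of.
case: {bd} d / (balanced_cases bd) => m; rewrite /height /entry /= !xpair_eqE;
(have [t ->] : exists t, m = c + t by exists (m - c); lia);
case: e0 => ->; case: e1 => ->; case: e2 => -> hk g0;
move: (sq_ge t 0) (sq_ge t 1) (sq_ge t (- 1)) (sq_ge t (- 2)); lia.
Qed.

(** Neighbours of the axis: with s = 1 and s = -1 these are the antipodal
    vertices of the octahedron centred at c(1,1,1). *)
Definition spike (c s : int) (i : 'I_3) : vec :=
  vec_of (fun j => c + s * (j == i)%:Z).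

Lemma octa_gap_eq0 c d : parity (c + 1) d -> balanced d ->
  octa_gap c d = 0 -> exists i, d = spike c 1 i \/ d = spike c (- 1) i.
Proof.
move=> [k + bd]; rewrite /octa_gap => hk g0.
suff: [|| d == spike c 1 v0, d == spike c (- 1) v0, d == spike c 1 v1,
   d == spike c (- 1) v1, d == spike c 1 v2 | d == spike c (- 1) v2].
  by case/or4P => [| | |/or3P[]] /eqP ->;
     [exists v0; left | exists v0; right | exists v1; left | exists v1; right
     | exists v2; left | exists v2; right].
move: hk g0; rewrite /spike /vec_of.
case: {bd} d / (balanced_cases bd) => m; rewrite /height /entry /= !xpair_eqE;
(have [t ->] : exists t, m = c + t by exists (m - c); lia);
move=> hk g0;
move: (sq_ge t 0) (sq_ge t 1) (sq_ge t (- 1)) (sq_ge t (- 2)); lia.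
Qed.

Lemma edge_gap_eq0 c s i d : `|s| = 1 -> parity (c + 1) d -> balanced d ->
  edge_gap c s i d = 0 ->
  [\/ d = spike c (- s) i, d = spike (c + 2 * s) (- s) i |
   exists2 j, j != i & d = spike c s j].
Proof.
move=> s1 [k + bd]; rewrite /edge_gap => hk g0.
suff: [|| d == spike c (- s) i, d == spike (c + 2 * s) (- s) i,
   (v0 != i) && (d == spike c s v0), (v1 != i) && (d == spike c s v1) |
   (v2 != i) && (d == spike c s v2)].
  case/or4P => [/eqP|/eqP|/andP[h /eqP]|/orP[/andP[h /eqP]|/andP[h /eqP]]];
    [constructor 1| constructor 2|constructor 3; exists v0
    |constructor 3; exists v1|constructor 3; exists v2] => //.
move: hk g0; rewrite /spike /vec_of.
have {s1} [->|->] : s = 1 \/ s = - 1 by lia.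
all: case: {bd} d / (balanced_cases bd) => m; rewrite /height /entry /= !xpair_eqE;
(have [t ->] : exists t, m = c + t by exists (m - c); lia);
move=> hk; move: i; apply: forall_I3 => /= g0;
move: (sq_ge t 0) (sq_ge t 1) (sq_ge t (- 1)) (sq_ge t (- 2)) (sq_ge t 2) (sq_ge t
  (- 3)); lia.
Qed.

(** * The tetrahedra are simplices *)

(** The coordinate along [eps i] r_i is an affine function, and what remains of
    2 counts the centre. *)
Lemma star_simplex c (eps : 'I_3 -> int) U V : (forall i, `|eps i| = 1) ->
  same_total U V ->
  (forall d, d \in U ++ V -> d = cst c \/ exists i, d = shift (eps i) i (cst c)) ->
  perm_eq U V.
Proof.
move=> eps1 eqUV vert; apply: perm_eq_of_functionals => // v /vert vE.
pose bary i (d : vec) := eps i * (height d - 3 * c - 2 * (entry d i - c)).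
have aff_bary i : affine (bary i).
  rewrite /bary /height; apply: (@affineI _ (- eps i * c)
   (eps i * (1 - 2 * (v0 == i)%:Z)) (eps i * (1 - 2 * (v1 == i)%:Z))
   (eps i * (1 - 2 * (v2 == i)%:Z))) => d.
  by move: i; apply: forall_I3 => /=; lia.
have e0 : eps v0 = 1 \/ eps v0 = - 1 by move: (eps1 v0); lia.
have e1 : eps v1 = 1 \/ eps v1 = - 1 by move: (eps1 v1); lia.
have e2 : eps v2 = 1 \/ eps v2 = - 1 by move: (eps1 v2); lia.
case: vE => [->|[i ->]].
  (* All barycentric coordinates are scaled by 2. *)
  exists (fun d => 2 - bary v0 d - bary v1 d - bary v2 d).
    rewrite /bary /height; pose e := eps v0 + eps v1 + eps v2.
    apply: (@affineI _ (2 + c * e) (2 * eps v0 - e) (2 * eps v1 -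
      e) (2 * eps v2 - e)).
    by move=> d; rewrite /e; lia.
  exists 2 => // d /vert [->|[j ->]];
    rewrite /bary /cst /shift /vec_of /height /entry /= !xpair_eqE.
    by lia.
  move: j; apply: forall_I3 => /=;
  case: e0 => ->; case: e1 => ->; case: e2 => ->; lia.
exists (bary i) => //; exists 2 => // d /vert [->|[j ->]];
  rewrite /bary /cst /shift /vec_of /height /entry /= !xpair_eqE.
  case: e0 => ?; case: e1 => ?; case: e2 => ?; move: i; apply: forall_I3 => /=; lia.
case: e0 => ?; case: e1 => ?; case: e2 => ?; move: i j; apply: forall_I3;
  apply: forall_I3 => /=; lia.
Qed.

Lemma edge_simplex c s i U V : `|s| = 1 -> same_total U V ->
  (forall d, d \in U ++ V -> [\/ d = spike c (- s) i,
    d = spike (c + 2 * s) (- s) i |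
   exists2 j, j != i & d = spike c s j]) ->
  perm_eq U V.
Proof.
move=> s1 eqUV vert; apply: perm_eq_of_functionals => // v /vert vE.
pose h (d : vec) := s * (height d - 3 * c).
pose x j (d : vec) := s * (entry d j - c).
have aff j (a0 a b e : int) :
  affine (fun d => a0 + a * h d + b * x j d + e * x i d).
  rewrite /h /x /height; apply: (@affineI _ (a0 - s * c * (3 * a + b + e))
    (s * (a + b * (v0 == j)%:Z + e * (v0 == i)%:Z))
    (s * (a + b * (v1 == j)%:Z + e * (v1 == i)%:Z))
    (s * (a + b * (v2 == j)%:Z + e * (v2 == i)%:Z))) => d.
  by move: i j {vert vE}; apply: forall_I3; apply: forall_I3 => /=; lia.
have {}s1 : s = 1 \/ s = - 1 by lia.
case: vE => [->|->|[j ji ->]].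
(* Twice the barycentric coordinate of the lower end of the long edge. *)
- exists (fun d => - 1 + 1 * h d + 0 * x i d + (- 4) * x i d); first exact: aff.
  exists 2 => // d /vert; clear vert aff; case=> [->|->|[k + ->]];
  rewrite /h /x /spike /vec_of /height /entry /= !xpair_eqE.
  + by case: s1 => ->; move: i; apply: forall_I3 => /=; lia.
  + by case: s1 => ->; move: i; apply: forall_I3 => /=; lia.
  + by case: s1 => ->; move: i k; apply: forall_I3; apply: forall_I3 => //=; lia.
(* Twice the coordinate of the upper end. *)
- exists (fun d => - 1 + 1 * h d + 0 * x i d + (- 2) * x i d); first exact: aff.
  exists 2 => // d /vert; clear vert aff; case=> [->|->|[k + ->]];
  rewrite /h /x /spike /vec_of /height /entry /= !xpair_eqE.
  + by case: s1 => ->; move: i; apply: forall_I3 => /=; lia.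
  + by case: s1 => ->; move: i; apply: forall_I3 => /=; lia.
  + by case: s1 => ->; move: i k; apply: forall_I3; apply: forall_I3 => //=; lia.
- exists (fun d => 1 + (- 1) * h d + 1 * x j d + 2 * x i d); first exact: aff.
  exists 1 => // d /vert; clear vert aff; case=> [->|->|[k + ->]];
  rewrite /h /x /spike /vec_of /height /entry /= !xpair_eqE.
  + by case: s1 => ->; move: i j ji; apply: forall_I3; apply: forall_I3 => //=; lia.
  + by case: s1 => ->; move: i j ji; apply: forall_I3; apply: forall_I3 => //=; lia.
  + by case: s1 => ->; move: i j k ji;
     apply: forall_I3; apply: forall_I3; apply: forall_I3 => //=; lia.
Qed.

(** * Stable families and supporting functions *)

(** The flows of walks with p steps have heights of the parity of p. Without
    this condition the cells would contain further points, such as the centres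
    of the octahedra. *)
Definition admissible (p : int) (d : vec) := balanced d /\ parity p d.

Definition stable (U : seq vec) := forall d e, d \in U -> e \in U ->
  ~~ improvable d e.

Definition simplicial (S : vec -> Prop) := forall A B, same_total A B ->
  (forall d, d \in A ++ B -> S d) -> perm_eq A B.

Definition octahedral (S : vec -> Prop) :=
  exists c, forall d, S d -> exists i, d = spike c 1 i \/ d = spike c (- 1) i.

(** The convex-geometric certificate that U lies in a cell, together with the
    shape of that cell. *)
Definition supports (p : int) (U : seq vec) (gap : vec -> int) :=
  [/\ energetic gap, forall d, admissible p d -> 0 <= gap d,
      forall d, d \in U -> gap d = 0 &
      simplicial (fun d => admissible p d /\ gap d = 0) \/
      octahedral (fun d => admissible p d /\ gap d = 0)].

Lemma supports_star p c eps U : (forall i, `|eps i| = 1) -> parity p (cst c) ->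
  (forall d, d \in U -> star_gap c eps d = 0) -> supports p U (star_gap c eps).
Proof.
move=> eps1 [k]; rewrite /height !entry_vec_of => hk U0.
have par d : parity p d -> parity c d by case=> m hm; exists (m + c - k); lia.
split=> //; first exact: star_gap_energetic.
  by move=> d [bd /par pd]; apply: star_gap_ge0.
left=> A B AB vert; apply: (star_simplex eps1 AB) => d /vert [[bd /par pd]].
exact: star_gap_eq0.
Qed.

Lemma supports_octa p c U : parity p (spike c 1 v0) ->
  (forall d, d \in U -> octa_gap c d = 0) -> supports p U (octa_gap c).
Proof.
move=> [k]; rewrite /height !entry_vec_of /= => hk U0.
have par d : parity p d -> parity (c + 1) d by case=> m hm; exists (m + c - k); lia.
split=> //; first exact: octa_gap_energetic.
  by move=> d [_ /par pd]; apply: octa_gap_ge0.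
by right; exists c => d [[bd /par pd]]; apply: octa_gap_eq0.
Qed.

Lemma supports_edge p c s i U : `|s| = 1 -> parity p (spike c s i) ->
  (forall d, d \in U -> edge_gap c s i d = 0) -> supports p U (edge_gap c s i).
Proof.
move=> s1 [k]; rewrite /height !entry_vec_of /= => hk U0.
have {}hk : exists m, p = c + 1 + 2 * m.
  have [s1'|s1'] : s = 1 \/ s = - 1 by lia.
  - by exists (c - k); move: hk; rewrite s1'; move: i {U0};
    apply: forall_I3 => /=; lia.
  - by exists (c - k - 1); move: hk; rewrite s1'; move: i {U0};
    apply: forall_I3 => /=; lia.
case: hk => m hm.
have par d : parity p d -> parity (c + 1) d by case=> n hn; exists (m + n); lia.
split=> //; first exact: edge_gap_energetic.
  by move=> d [bd /par pd]; apply: edge_gap_ge0.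
left=> A B AB vert; apply: (edge_simplex s1 AB) => d /vert [[bd /par pd]].
exact: edge_gap_eq0.
Qed.

(** The classification of stable families reads off the cell from a flow of
    least height. *)
Lemma lowest (U : seq vec) : U != [::] ->
  exists2 d, d \in U & forall e, e \in U -> height d <= height e.
Proof.
elim: U => // d [|e U] IH _.
  by exists d; rewrite ?mem_head // => x; rewrite inE => /eqP ->.
have [//|x xU lex] := IH; have [le|lt] := leP (height d) (height x).
  exists d; rewrite ?mem_head // => y; rewrite inE => /orP [/eqP -> //|/lex].
  exact: le_trans.
exists x; first by rewrite inE xU orbT.
by move=> y; rewrite inE => /orP [/eqP ->|/lex //]; apply: ltW.
Qed.

Lemma stable_far_locked U d e : stable U -> d \in U -> e \in U ->
  height d + 4 <= height e ->
  locked d e /\ height e < height d + 8.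
Proof.
move=> st dU eU h4; have := st d e dU eU; rewrite /improvable h4 /=.
rewrite negb_or negbK => /andP [h8 ->]; split=> //; lia.
Qed.

(** In a stable family, two flows at height distance 6 are locked, hence differ
    by 2(1,1,1) and span a long boundary edge. Every other flow must be locked
    with an end of that edge that is at least 4 away from it, which puts it on
    the tetrahedron around the edge. *)
Lemma stable_long_edge p U d0 w :
  stable U -> (forall d, d \in U -> admissible p d) -> d0 \in U -> w \in U ->
  (forall e, e \in U -> height d0 <= height e) ->
  height w = height d0 + 6 -> exists gap, supports p U gap.
Proof.
move=> st adm d0U wU low hw.
have [lk _] : locked d0 w /\ height w < height d0 + 8
  by apply: (stable_far_locked st) => //; lia.
have near d : d \in U ->
  [/\ height d <= height d0 + 6,
      height d0 + 4 <= height d -> locked d0 d & height d <= height d0 + 2 ->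
        locked d w].
  move=> dU; split; first have [//|h] := leP (height d) (height d0 + 6).
  - have [|_] := stable_far_locked st d0U dU; first by lia.
    have [k1 h1] := (adm _ dU).2; have [k2 h2] := (adm _ d0U).2; lia.
  - by move=> h; have [] := stable_far_locked st d0U dU h.
  - by move=> h; have [|//] := stable_far_locked st dU wU; lia.
have step d : d \in U -> exists k, height d = height d0 + 2 * k.
  move=> dU; have [k1 h1] := (adm _ dU).2; have [k2 h2] := (adm _ d0U).2.
  by exists (k1 - k2); lia.
have pw := (adm _ wU).2.
have pd0 := (adm _ d0U).2.
have bal d : d \in U -> balanced d by case/adm.
have [bd0 bw] := (bal _ d0U, bal _ wU).
have goal c s i : `|s| = 1 -> parity p (spike c s i) ->
  (forall d, balanced d -> height d0 <= height d <= height d0 + 6 ->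
     (exists k, height d = height d0 + 2 * k) ->
     (height d0 + 4 <= height d -> locked d0 d) ->
     (height d <= height d0 + 2 -> locked d w) -> edge_gap c s i d = 0) ->
  exists gap, supports p U gap.
  move=> s1 pc g0; exists (edge_gap c s i); apply: supports_edge => // d dU.
  have [n1 n2 n3] := near d dU.
  by apply: g0 => //; [apply: bal | rewrite low | apply: step].
move: lk pd0 pw hw goal {adm near step bal low st wU d0U}; rewrite !lockedE.
case: {bd0} d0 / (balanced_cases bd0) => k;
case: {bw} w / (balanced_cases bw) => l; rewrite /height /entry /=; try lia.
all: move=> _ [m hm] _ hw goal.
1: apply: (goal (k + 2) (- 1) v0) => //.
3: apply: (goal (k + 2) (- 1) v1) => //.
5: apply: (goal (k + 2) (- 1) v2) => //.
7: apply: (goal (k + 1) 1 v0) => //.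
9: apply: (goal (k + 1) 1 v1) => //.
11: apply: (goal (k + 1) 1 v2) => //.
1,3,5: by exists (m + 2); move: hm; rewrite /height /entry /=; lia.
4,6,8: by exists (m + 1); move: hm; rewrite /height /entry /=; lia.
all: move=> d bd; rewrite !lockedE /edge_gap /height.
all: case: {bd} d / (balanced_cases bd) => n; rewrite /entry /= => low [t ht] h1 h2.
all: have [E|[E|E]] : n = k \/ n = k + 1 \/ n = k + 2 by lia.
all: subst n; lia.
Qed.

(** * Two stable families with the same total *)

(** The three layers by their position relative to the axis. *)
Variant kind_spec : vec -> Prop :=
  | KindO k : kind_spec (cst k)
  | KindP k i : kind_spec (spike k 1 i)
  | KindN k i : kind_spec (spike k (- 1) i).

Lemma spikeE c s i : spike c s i =
  (c + s * (v0 == i)%:Z, c + s * (v1 == i)%:Z, c + s * (v2 == i)%:Z).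
Proof. by []. Qed.

Lemma kind_cases d : balanced d -> kind_spec d.
Proof.
move=> bd; case: {bd} d / (balanced_cases bd) => k; first exact: (KindO k).
1: rewrite (_ : (_, _, _) = spike k 1 v0); first exact: KindP.
2: rewrite (_ : (_, _, _) = spike k 1 v1); first exact: KindP.
3: rewrite (_ : (_, _, _) = spike k 1 v2); first exact: KindP.
4: rewrite (_ : (_, _, _) = spike (k + 1) (- 1) v0); first exact: KindN.
5: rewrite (_ : (_, _, _) = spike (k + 1) (- 1) v1); first exact: KindN.
6: rewrite (_ : (_, _, _) = spike (k + 1) (- 1) v2); first exact: KindN.
all: by rewrite spikeE /=; apply/eqP; rewrite !xpair_eqE; lia.
Qed.

Lemma height_cst k : height (cst k) = 3 * k.
Proof. rewrite /height !entry_vec_of; lia. Qed.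

Lemma height_spike c s i : height (spike c s i) = 3 * c + s.
Proof. by rewrite /height !entry_vec_of; move: i; apply: forall_I3 => /=; lia. Qed.

Lemma star_gap_center c eps : star_gap c eps (cst c) = 0.
Proof. by rewrite /star_gap height_cst !entry_vec_of; lia. Qed.

Lemma star_gap_ray c (eps : 'I_3 -> int) s i : `|s| = 1 -> eps i = s ->
  star_gap c eps (spike (c + s) (- s) i) = 0.
Proof.
rewrite /star_gap height_spike !entry_vec_of => s1 ei;
  have [E|E] : s = 1 \/ s = - 1 by lia.
  all: by move: i ei; apply: forall_I3 => /= ->; rewrite E; lia.
Qed.

Lemma lockedE_cst k d : locked (cst k) d = false.
Proof. by apply/existsP => -[i /existsP [j]]; rewrite !entry_vec_of subrr. Qed.

Lemma locked_spikes c c' i j : locked (spike c 1 i) (spike c' (- 1) j) = (i != j).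
Proof.
rewrite lockedE !entry_vec_of.
by move: i j; apply: forall_I3; apply: forall_I3 => /=; lia.
Qed.

(** Apart from the case of a long edge, a family with a lowest flow at height h
    has its heights in {h, h + 2, h + 4}. If that flow is on the axis, nothing
    locks with it and h + 4 is excluded, so that all flows lie on the star of
    the axis point with rays upwards. If it is c(1,1,1) + e_i, then c + 1 gives
    the centre of a star; for each i only one of the two opposite rays can
    occur, and it fixes the sign. If it is c(1,1,1) - e_i, the family lies in
    an octahedron. *)
Lemma stable_supports p U : U != [::] -> (forall d, d \in U -> admissible p d) ->
  stable U -> exists gap, supports p U gap.
Proof.
move=> U0 adm st; have [d0 d0U low] := lowest U0.
have [|no6] := boolP (has (fun w => height w == height d0 + 6) U).
  by case/hasP => w wU /eqP; apply: stable_long_edge.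
have {no6} short d : d \in U ->
  exists k, height d = height d0 + 2 * k /\ 0 <= k <= 2.
  move=> dU; have [k1 h1] := (adm _ dU).2; have [k2 h2] := (adm _ d0U).2.
  exists (k1 - k2); have := low _ dU; have := hasPn no6 d dU.
  have [h4|] := leP (height d0 + 4) (height d); last by lia.
  by have [_] := stable_far_locked st d0U dU h4; lia.
have par := (adm _ d0U).2.
have bd0 := (adm _ d0U).1.
move: d0U low short par; case: {bd0} d0 / (kind_cases bd0) => [k|k i|k i] d0U low
  short par.
- exists (star_gap k (fun=> 1)); apply: supports_star => // d dU.
  have [m] := short d dU; rewrite height_cst => -[hm m02].
  have {m02} : m = 0 \/ m = 1.
    have [h4|] := leP (height (cst k) + 4) (height d);
      last by rewrite height_cst; lia.
    by have [] := stable_far_locked st d0U dU h4; rewrite lockedE_cst.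
  by rewrite /star_gap hm /height => -[] E; subst m; move: hm;
    rewrite /height => hm; lia.
(* The ray in direction j points upwards if its upper end occurs; its lower end
   is then excluded, as it would form an improvable pair with the upper one. *)
- pose eps j : int := if spike (k + 2) (- 1) j \in U then 1 else - 1.
  exists (star_gap (k + 1) eps); apply: supports_star => [j||d dU].
  + by rewrite /eps; case: ifP.
  + case: par => m; rewrite height_spike => hm; exists (m + 1);
    rewrite height_cst; lia.
  have [m] := short d dU; rewrite height_spike => -[+ m02].
  have bd : balanced d by case: (adm d dU).
  move: dU; case: {bd} d / (kind_cases bd) => [l|l j|l j] dU;
    rewrite ?height_cst ?height_spike => hl.
  + have -> : l = k + 1 by lia.
    exact: star_gap_center.
  + have {hl m02} El : l = k by lia.
    subst l.
    rewrite -[X in spike X _ _](addrK 1 k); apply: star_gap_ray => //.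
    rewrite /eps; case: ifP => // NU.
    by have [] := stable_far_locked st dU NU;
      rewrite ?height_spike ?locked_spikes ?eqxx //; lia.
  + have {hl m02} El : l = k + 1 + 1 by lia.
    subst l; apply: star_gap_ray => //.
    by rewrite /eps; move: dU; rewrite -addrA => ->.
- exists (octa_gap k); apply: supports_octa => [|d dU].
    by case: par => m; rewrite height_spike => hm; exists (m + 1);
      rewrite height_spike; lia.
  have [m] := short d dU; rewrite height_spike => -[hm m02].
  have {m02} : m = 0 \/ m = 1.
    have [h4|] := leP (height (spike k (- 1) i) + 4) (height d);
      last by rewrite height_spike; lia.
    have [lk _] := stable_far_locked st d0U dU h4.
    move: lk hm m02 h4; have bd : balanced d by case: (adm d dU).
    rewrite height_spike; case: {bd dU} d / (kind_cases bd) => [l|l j|l j];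
    rewrite ?height_cst ?height_spike; try lia.
    rewrite lockedE !entry_vec_of; lia.
  by rewrite /octa_gap hm => -[] ->; lia.
Qed.

Definition energy (U : seq vec) : int := \sum_(d <- U) height d * height d.

Lemma gap_energy gap U V : energetic gap -> same_total U V ->
  \sum_(d <- U) gap d - energy U = \sum_(d <- V) gap d - energy V.
Proof. by move=> en UV; rewrite -!sumrB; apply: affine_sum UV. Qed.

(** The gap vanishes on U, and its affine part cannot tell U from V. *)
Lemma stable_energy p U V gap : supports p U gap -> same_total U V ->
  (forall d, d \in V -> admissible p d) ->
    \sum_(d <- V) gap d = energy V - energy U.
Proof.
case=> en ge0 U0 _ UV admV; have := gap_energy en UV.
by rewrite [X in X - _]big_seq [X in X - _]big1 // sub0r => /esym /eqP;
  rewrite subr_eq addrC => /eqP.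
Qed.

(** Applying [stable_energy] in both directions shows that both families have
    the same energy. Then the gap of the first one has sum zero, and so
    vanishes, on the second one. *)
Lemma stable_unique p U V : same_total U V -> stable U -> stable V ->
  (forall d, d \in U ++ V -> admissible p d) ->
  perm_eq U V \/
  exists c, forall d, d \in U ++ V ->
    exists i, d = spike c 1 i \/ d = spike c (- 1) i.
Proof.
move=> UV stU stV adm.
have admU d : d \in U -> admissible p d by move=> dU; apply: adm;
  rewrite mem_cat dU.
have admV d : d \in V -> admissible p d by move=> dV; apply: adm;
  rewrite mem_cat dV orbT.
have [U0|Un0] := eqVneq U [::].
  by left; case: UV; rewrite U0 => /esym /size0nil ->.
have Vn0 : V != [::] by apply: contraNneq Un0 => V0; rewrite -size_eq0 UV.1 V0.
have VU : same_total V U by case: UV => szUV totUV; split=> [|i];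
  rewrite ?szUV ?totUV.
have [gap supU] := stable_supports Un0 admU stU.
have [gap' supV] := stable_supports Vn0 admV stV.
have EV := stable_energy supU UV admV; have EU := stable_energy supV VU admU.
have [_ ge0 gapU cellU] := supU; have [_ ge0' _ _] := supV.
have sum0 : \sum_(d <- V) gap d = 0.
  apply/eqP; rewrite eq_le; apply/andP; split.
    rewrite EV -oppr_ge0 opprB -EU.
    by rewrite big_seq; apply: sumr_ge0 => d /admU; apply: ge0'.
  by rewrite big_seq; apply: sumr_ge0 => d /admV; apply: ge0.
have gapV d : d \in V -> gap d = 0.
  move: sum0; rewrite big_seq => /eqP; rewrite psumr_eq0 => [/allP h dV|x /admV];
    last exact: ge0.
  by move: (h d dV); rewrite dV => /eqP.
have gap0 d : d \in U ++ V -> admissible p d /\ gap d = 0.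
  by move=> dUV; split; [apply: adm | move: dUV;
    rewrite mem_cat => /orP [/gapU|/gapV]].
case: cellU => [simp|[c octc]]; first by left; apply: simp.
by right; exists c => d /gap0; apply: octc.
Qed.

(** * Profiles and moves on pairs of words *)

(** A pair of flow and loops. *)
Definition profile := (vec * vec)%type.

(** The condition on heights is the number of steps: for a balanced flow, the
    absolute values of the entries add up to the absolute value of the height,
    and every loop consists of two steps. *)
Definition valid (N : int) (x : profile) : Prop :=
  [/\ balanced x.1, forall i, 0 <= entry x.2 i &
      `|height x.1| + 2 * height x.2 = N].

Definition allvalid N (s : seq profile) := forall x, x \in s -> valid N x.

(** Steps against the cyclic direction. *)
Definition back (x : profile) (i : 'I_3) : int := neg x.1 i + entry x.2 i.

Definition flows (s : seq profile) : seq vec := [seq x.1 | x <- s].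
Definition loops (s : seq profile) : seq vec := [seq x.2 | x <- s].

Lemma flows_cons x s : flows (x :: s) = x.1 :: flows s. Proof. by []. Qed.
Lemma loops_cons x s : loops (x :: s) = x.2 :: loops s. Proof. by []. Qed.

Definition backs (s : seq profile) (i : 'I_3) : int := \sum_(x <- s) back x i.

Lemma backs_cons x s i : backs (x :: s) i = back x i + backs s i.
Proof. exact: big_cons. Qed.

Definition negs (U : seq vec) (i : 'I_3) : int := \sum_(d <- U) neg d i.

Lemma backsE s i : backs s i = negs (flows s) i + total (loops s) i.
Proof. by rewrite /backs /negs /total !big_map -big_split. Qed.

Lemma perm_total U V i : perm_eq U V -> total U i = total V i.
Proof. by move=> UV; apply: perm_big. Qed.

Lemma perm_negs U V i : perm_eq U V -> negs U i = negs V i.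
Proof. by move=> UV; apply: perm_big. Qed.

Lemma perm_backs s t i : perm_eq s t -> backs s i = backs t i.
Proof. by move=> st; apply: perm_big. Qed.

Lemma perm_allvalid N s t : perm_eq s t -> allvalid N s -> allvalid N t.
Proof. by move=> st vs x; rewrite -(perm_mem st); apply: vs. Qed.

Lemma perm_flows s t : perm_eq s t -> perm_eq (flows s) (flows t).
Proof. exact: perm_map. Qed.

Lemma perm_loops (s t : seq profile) i :
  perm_eq s t -> total (loops s) i = total (loops t) i.
Proof. by move=> st; apply/perm_total/perm_map. Qed.

(** Together these fix the number of steps in either direction along each
    edge. *)
Definition same_sums (s t : seq profile) : Prop :=
  same_total (flows s) (flows t) /\ backs s =1 backs t.

Lemma same_sums_refl s : same_sums s s. Proof. by []. Qed.

Lemma same_sums_trans s t u : same_sums s t -> same_sums t u -> same_sums s u.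
Proof.
case=> -[sz1 tot1] b1 [[sz2 tot2] b2].
by split=> [|i]; [split=> [|i]|]; rewrite ?sz1 ?tot1 ?b1.
Qed.

Lemma same_sums_sym s t : same_sums s t -> same_sums t s.
Proof.
case=> -[sz1 tot1] b1.
by split=> [|i]; [split=> [|i]|]; rewrite ?sz1 ?tot1 ?b1.
Qed.

Lemma same_sums_perm s t : perm_eq s t -> same_sums s t.
Proof.
move=> st; split=> [|i]; last exact: perm_backs.
by split=> [|i]; [apply/perm_size/perm_map | apply/perm_total/perm_map].
Qed.

Lemma same_sums_pair x y x' y' s :
  (forall i, entry x'.1 i + entry y'.1 i = entry x.1 i + entry y.1 i) ->
  (forall i, back x' i + back y' i = back x i + back y i) ->
  same_sums (x :: y :: s) (x' :: y' :: s).
Proof.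
move=> e1 e2; split=> [|i]; last by rewrite !backs_cons; move: (e2 i); lia.
by split=> // i; rewrite !flows_cons !total_cons; move: (e1 i); lia.
Qed.

(** All that the connectivity argument uses of the relation to be proved. *)
Record congruence (N : int)
    (E : seq profile -> seq profile -> Prop) : Prop := Congruence {
  congr_sym : forall s t, E s t -> E t s;
  congr_trans : forall s t u, E s t -> E t u -> E s u;
  congr_perm : forall s t, perm_eq s t -> E s t;
  congr_cons : forall x s t, E s t -> E (x :: s) (x :: t);
  congr_pair : forall x y x' y' s, valid N x -> valid N y -> valid N x' ->
    valid N y' ->
    (forall i, entry x'.1 i + entry y'.1 i = entry x.1 i + entry y.1 i) ->
    (forall i, back x' i + back y' i = back x i + back y i) ->
    E (x :: y :: s) (x' :: y' :: s) }.

Definition move_unit (i l : 'I_3) (m : vec) : vec :=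
  vec_of (fun j => entry m j - (j == i)%:Z + (j == l)%:Z).

Lemma height_move_unit i l m : height (move_unit i l m) = height m.
Proof.
rewrite /height !entry_vec_of.
by move: i l; apply: forall_I3; apply: forall_I3 => /=; lia.
Qed.

Lemma total_pos_mem U i : 0 < total U i -> exists2 d, d \in U & 0 < entry d i.
Proof.
elim: U => [|d U IH]; first by rewrite /total big_nil.
rewrite total_cons => h; have [d0|d0] := ltP 0 (entry d i).
  by exists d; rewrite ?mem_head.
have [|e eU e0] := IH; first by lia.
by exists e; rewrite // inE eU orbT.
Qed.

Lemma loops_pos_mem (s : seq profile) i : 0 < total (loops s) i ->
  exists2 x : profile, x \in s & 0 < entry x.2 i.
Proof. by case/total_pos_mem => m /mapP [x xs ->] xi; exists x. Qed.

Definition dist (m n : vec) : int :=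
  `|entry m v0 - entry n v0| + `|entry m v1 - entry n v1| +
  `|entry m v2 - entry n v2|.

Section Connect.
Variables (N : int) (E : seq profile -> seq profile -> Prop).
Hypothesis cE : congruence N E.

(** While the loops of x differ from the prescribed ones, some unit i is in
    excess and some unit l is missing. A unit l is available in another
    profile, and the two units can be exchanged because all loops of one
    profile are interchangeable. *)
Lemma align_head (n : nat) x y s : dist x.2 y.2 <= n ->
  allvalid N (x :: s) -> valid N y -> x.1 = y.1 ->
  (forall i, entry y.2 i <= total (loops (x :: s)) i) ->
  exists t, [/\ E (x :: s) (y :: t), allvalid N t, perm_eq (flows s) (flows t) &
    backs (x :: s) =1 backs (y :: t)].
Proof.
elim: n x s => [|n IH] x s dn vs vy xy avail.
  have -> : x = y.
    move: xy dn; case: x {vs avail} => d m; case: y {vy} => e m' /= -> dn;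
      congr (_, _).
    by apply: vec_ext; move: dn; rewrite /dist => dn; apply: forall_I3; lia.
  exists s; split; [exact: (congr_perm cE) | | exact: perm_refl | by []].
  by move=> z zs; apply: vs; rewrite inE zs orbT.
have [vx1 vx2 vx3] := vs x (mem_head _ _); have [vy1 vy2 vy3] := vy.
have eqh : height x.2 = height y.2 by move: vx3 vy3; rewrite xy; lia.
have [d0|d1] := leP (dist x.2 y.2) n; first exact: IH.
have [i xi] : exists i, entry y.2 i < entry x.2 i.
  have: [|| entry y.2 v0 < entry x.2 v0, entry y.2 v1 < entry x.2 v1
          | entry y.2 v2 < entry x.2 v2] by move: d1 eqh; rewrite /dist /height;
            lia.
  by case/or3P => ?; [exists v0|exists v1|exists v2].
have [l xl] : exists l, entry x.2 l < entry y.2 l.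
  have: [|| entry x.2 v0 < entry y.2 v0, entry x.2 v1 < entry y.2 v1
          | entry x.2 v2 < entry y.2 v2] by move: d1 eqh; rewrite /dist /height;
            lia.
  by case/or3P => ?; [exists v0|exists v1|exists v2].
have [|z zs zl] := @loops_pos_mem s l.
  by have := avail l; rewrite loops_cons total_cons; lia.
have il : i != l by apply: contraTneq xi => ->; lia.
pose x1 : profile := (x.1, move_unit i l x.2).
pose z1 : profile := (z.1, move_unit l i z.2).
have ps := perm_to_rem zs.
have vz : valid N z by apply: vs; rewrite inE zs orbT.
have vx : valid N x by apply: vs; rewrite mem_head.
have vx1' : valid N x1.
  split=> //=; last by rewrite height_move_unit.
  by move=> j; rewrite entry_vec_of; have := vx2 j; have := vy2 i;
    case: eqP => [->|]; lia.
have vz1 : valid N z1.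
  have [vz1 vz2 vz3] := vz.
  split=> //=; last by rewrite height_move_unit.
  by move=> j; rewrite entry_vec_of; have := vz2 j; case: eqP => [->|_]; lia.
have back1 j : back x1 j + back z1 j = back x j + back z j.
  by rewrite /back /= !entry_vec_of; lia.
have mv : E (x :: s) (x1 :: z1 :: rem z s).
  have p1 : E (x :: s) (x :: z :: rem z s) by apply: (congr_perm cE);
    rewrite perm_cons.
  by apply: (congr_trans cE p1); apply: (congr_pair cE).
have [| | | | |t [Et vt pt bt]] := IH x1 (z1 :: rem z s) => //.
- move: d1 dn xi xl il; rewrite /dist /x1 /= !entry_vec_of.
  by move: i l {avail zl x1 z1 vx1' vz1 back1 mv}; apply: forall_I3;
    apply: forall_I3 => //=; lia.
- move=> w; rewrite !inE => /or3P [/eqP ->|/eqP ->|/mem_rem ws] //.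
  by apply: vs; rewrite inE ws orbT.
- move=> j; have := avail j; have := perm_loops j ps.
  by rewrite !loops_cons !total_cons !entry_vec_of; lia.
exists t; split => //.
- exact: (congr_trans cE mv Et).
- exact: perm_trans (perm_flows ps) pt.
- move=> j; rewrite -bt; move: (back1 j) (perm_backs j ps).
  by rewrite !backs_cons; lia.
Qed.

(** The profiles are adjusted one after the other; the one just adjusted is not
    touched again. *)
Lemma align s t : allvalid N s -> allvalid N t -> perm_eq (flows s) (flows t) ->
  backs s =1 backs t -> E s t.
Proof.
elim: t s => [|y t IH] s vs vt pst bst.
  case: s vs pst bst => [|x s] _ pst _; last by move/perm_size: pst.
  exact: (congr_perm cE).
have : y.1 \in flows s by rewrite (perm_mem pst) mem_head.
case/mapP => x xs yx; have ps := perm_to_rem xs.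
have vs' := perm_allvalid ps vs.
have loops_eq i : total (loops s) i = total (loops (y :: t)) i.
  by have := bst i; rewrite !backsE (perm_negs i pst); lia.
have loops_ge0 i : 0 <= total (loops t) i.
  rewrite /total big_map big_seq; apply: sumr_ge0 => z zt.
  by have [] : valid N z by apply: vt; rewrite inE zt orbT.
have vy : valid N y by apply: vt; rewrite mem_head.
have [||t1 [Et1 vt1 pt1 bt1]] :=
  @align_head `|dist x.2 y.2|%N x y (rem x s) _ vs' vy (esym yx).
- by rewrite abszE ler_norm.
- move=> i; rewrite -(perm_loops i ps) loops_eq loops_cons total_cons;
  have := loops_ge0 i; lia.
have pflow : perm_eq (flows t1) (flows t).
  have p1 : perm_eq (x.1 :: flows (rem x s)) (y.1 :: flows t).
    by apply: perm_trans pst; rewrite perm_sym; apply: perm_flows ps.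
  by move: p1; rewrite yx perm_cons; apply: perm_trans; rewrite perm_sym.
apply: (congr_trans cE (congr_perm cE ps)); apply: (congr_trans cE Et1).
apply: (congr_cons cE); apply: IH => //.
  by move=> z zt; apply: vt; rewrite inE zt orbT.
by move=> i; move: (bt1 i) (bst i); rewrite (perm_backs i ps) !backs_cons; lia.
Qed.

Lemma split_vec (m : vec) (h : int) : (forall i, 0 <= entry m i) ->
  0 <= h <= height m ->
  exists n, height n = h /\ forall i, 0 <= entry n i <= entry m i.
Proof.
move=> m0 hm; move: (m0 v0) (m0 v1) (m0 v2) => q0 q1 q2.
have [a ha] : exists a, a = Num.min (entry m v0) h by eexists.
have [b hb] : exists b, b = Num.min (entry m v1) (h - a) by eexists.
exists (a, b, h - a - b); split; first by rewrite /height /entry /=; lia.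
by apply: forall_I3; rewrite {1 2}/entry /=; move: hm; rewrite /height; lia.
Qed.

(** The entries of a balanced vector never have opposite signs. *)
Lemma height_neg d : balanced d ->
  neg d v0 + neg d v1 + neg d v2 = Num.max (- height d) 0.
Proof.
move=> bd; case: {bd} d / (balanced_cases bd) => k;
  rewrite /neg /height /entry /=; lia.
Qed.

(** After the flows have been replaced, the freed steps against the cyclic
    direction become loops; the condition on the number of steps only
    prescribes how many of all the available loops go to each of the two
    profiles. *)
Lemma improve_pair x y : valid N x -> valid N y -> improvable x.1 y.1 ->
  exists x' y', [/\ valid N x', valid N y',
    forall i, entry x'.1 i + entry y'.1 i = entry x.1 i + entry y.1 i,
    forall i, back x' i + back y' i = back x i + back y i &
    height x'.1 * height x'.1 + height y'.1 * height y'.1 <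
    height x.1 * height x.1 + height y.1 * height y.1].
Proof.
move: x y => [d m] [e n] [/= bd m0 dm] [/= be n0 en] imp.
have [k hk] : exists k, height e = height d + 2 * k
  by exists ((height e - height d) %/ 2)%Z; lia.
have [d' [e' [k' [[bd' be'] eqs le_neg hd' k0k]]]] := improve bd be imp hk.
have hde' : height e' = height e - 2 * k'.
  by move: (eqs v0) (eqs v1) (eqs v2) hd'; rewrite /height; lia.
(* All loops available to the two new profiles. *)
pose M := vec_of (fun i => entry m i + entry n i + neg d i +
  neg e i - neg d' i - neg e' i).
have ME i : entry M i = entry m i + entry n i + neg d i +
  neg e i - neg d' i - neg e' i.
  exact: entry_vec_of.
have [h hh] : exists h, `|height d'| + 2 * h = N
  by exists ((N - `|height d'|) %/ 2)%Z; lia.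
have hM : 2 * height M = 2 * N - `|height d'| - `|height e'|.
  move: (height_neg bd) (height_neg be) (height_neg bd') (height_neg be') dm en.
  by rewrite /(height M) /(height m) /(height n) !ME; lia.
have M0 i : 0 <= entry M i by rewrite ME; move: (m0 i) (n0 i) (le_neg i); lia.
have hhM : 0 <= h <= height M.
  have m0' : 0 <= height m by rewrite /height; move: (m0 v0) (m0 v1) (m0 v2); lia.
  have n0' : 0 <= height n by rewrite /height; move: (n0 v0) (n0 v1) (n0 v2); lia.
  by lia.
have [q [qh q0]] := split_vec M0 hhM.
exists (d', q), (e', vec_of (fun i => entry M i - entry q i)); split => //=.
- by split=> //= [i|]; [move: (q0 i); lia | lia].
- split=> //= [i|]; first by rewrite entry_vec_of; move: (q0 i); lia.
  have : height (vec_of (fun i => entry M i - entry q i)) = height M - height q.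
    by rewrite /height !entry_vec_of; lia.
  lia.
- by move=> i; rewrite /back /= entry_vec_of ME; lia.
- have : 0 < k' * (k - k') by apply: mulr_gt0; lia.
  by rewrite hde' hd' hk; lia.
Qed.

Definition flow_energy s := energy (flows s).

Lemma flow_energy_cons x s : flow_energy (x :: s) =
  height x.1 * height x.1 + flow_energy s.
Proof. exact: big_cons. Qed.

Lemma flow_energy_ge0 s : 0 <= flow_energy s.
Proof. by apply: sumr_ge0 => d _; rewrite -expr2 sqr_ge0. Qed.

Lemma improvable_irrefl d : improvable d d = false.
Proof. by rewrite /improvable; lia. Qed.

Lemma descend s : allvalid N s ->
  exists t, [/\ E s t, allvalid N t, same_sums s t & stable (flows t)].
Proof.
have [n] := ubnP `|flow_energy s|%N; elim: n s => // n IH s sn vs.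
have [|st] := boolP (has (fun x => has (fun y => improvable x.1 y.1) s) s);
  last first.
  exists s; split=> //; first exact: (congr_perm cE).
  move=> d e /mapP [x xs ->] /mapP [y ys ->].
  by have /hasPn := hasPn st x xs; apply.
move=> imps; have {imps} [x [y [xs ys imp]]] :
    exists x y : profile, [/\ x \in s, y \in s & improvable x.1 y.1].
  by case/hasP: imps => x xs /hasP [y ys imp]; exists x, y.
have yx : y \in rem x s.
  have := ys; rewrite (perm_mem (perm_to_rem xs)) inE => /orP [/eqP E'|//].
  by move: imp; rewrite E' improvable_irrefl.
have ps : perm_eq s (x :: y :: rem y (rem x s)).
  by apply: (perm_trans (perm_to_rem xs)); rewrite perm_cons perm_to_rem.
have [x' [y' [vx' vy' eq1 eq2 lt]]] := improve_pair (vs x xs) (vs y ys) imp.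
set r := rem y (rem x s) in ps.
have vr : allvalid N r by move=> z zr; apply: vs;
  rewrite (perm_mem ps) !inE zr !orbT.
have en : flow_energy s = height x.1 * height x.1 + (height y.1 * height y.1 +
  flow_energy r).
  by rewrite -!flow_energy_cons; apply: perm_big; apply: perm_flows.
have [||t [Et vt sums st]] := IH (x' :: y' :: r).
- move: (flow_energy_ge0 s) (flow_energy_ge0 (x' :: y' :: r)) sn lt en.
  by rewrite !flow_energy_cons; lia.
- by move=> z; rewrite !inE => /or3P [/eqP ->|/eqP ->|/vr].
exists t; split=> //.
- apply: (congr_trans cE (congr_perm cE ps)); apply: (congr_trans cE _ Et).
  by apply: (congr_pair cE) => //; apply: vs.
- apply: (same_sums_trans (same_sums_perm ps)); apply: same_sums_trans sums.
  exact: same_sums_pair.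
Qed.
End Connect.

(** * Families in an octahedron *)

Definition in_octahedron (c : int) (U : seq vec) :=
  forall d, d \in U -> exists i, d = spike c 1 i \/ d = spike c (- 1) i.

Definition vcount (c s : int) (U : seq vec) (i : 'I_3) : int :=
  (count_mem (spike c s i) U)%:Z.

Lemma vcount_cons c s d U i : vcount c s (d :: U) i =
  (d == spike c s i)%:Z + vcount c s U i.
Proof. by rewrite /vcount /= PoszD. Qed.

Lemma spike_eq (c s s' : int) i j : `|s| = 1 -> `|s'| = 1 ->
  (spike c s i == spike c s' j) = (s == s') && (i == j).
Proof.
move=> s1 s1'; rewrite !spikeE !xpair_eqE.
have [->|->] : s = 1 \/ s = - 1 by lia.
all: have [->|->] : s' = 1 \/ s' = - 1 by lia.
all: by rewrite -[i == j]val_eqE; move: i j; apply: forall_I3;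
  apply: forall_I3 => /=; lia.
Qed.

Lemma octahedron_total c U i : in_octahedron c U ->
  total U i = c * (size U)%:Z + vcount c 1 U i - vcount c (- 1) U i.
Proof.
elim: U => [|d U IH] oU; first by rewrite /total /vcount big_nil /=; lia.
rewrite total_cons !vcount_cons IH => [|e eU]; last by apply: oU;
  rewrite inE eU orbT.
have [j [->|->]] := oU d (mem_head _ _);
  rewrite !spike_eq // entry_vec_of [i == j]eq_sym /=;
by case: eqP => _ /=; lia.
Qed.

Lemma octahedron_size c U : in_octahedron c U ->
  (size U)%:Z = vcount c 1 U v0 + vcount c 1 U v1 + vcount c 1 U v2
     + vcount c (- 1) U v0 + vcount c (- 1) U v1 + vcount c (- 1) U v2.
Proof.
elim: U => [|d U IH] oU //.
have [j dj] := oU d (mem_head _ _).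
have /IH {}IH : in_octahedron c U by move=> e eU; apply: oU; rewrite inE eU orbT.
move: IH; rewrite !vcount_cons /=.
have -> : (size U).+1%:Z = (size U)%:Z + 1 by lia.
by case: dj => ->; rewrite !spike_eq //; move: j; apply: forall_I3 => /=; lia.
Qed.

(** Around the origin the upper vertices are flows in the cyclic direction and
    the lower ones against it, so that trading antipodal pairs has an effect on
    the loops. *)
Lemma octahedron_negs U i : in_octahedron 0 U -> negs U i = vcount 0 (- 1) U i.
Proof.
elim: U => [|d U IH] oU; first by rewrite /negs big_nil.
rewrite /negs big_cons vcount_cons -/(negs U i) IH => [|e eU]; last by apply: oU;
  rewrite inE eU orbT.
by have [j [->|->]] := oU d (mem_head _ _);
  rewrite !spike_eq // /neg entry_vec_of [i == j]eq_sym /=; lia.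
Qed.

(** The total fixes the difference of the multiplicities of antipodal
    vertices. *)
Lemma octahedron_perm c U V : in_octahedron c U -> in_octahedron c V ->
  same_total U V ->
  vcount c (- 1) U =1 vcount c (- 1) V -> perm_eq U V.
Proof.
move=> oU oV [sz tot] nn.
have pp i : vcount c 1 U i = vcount c 1 V i.
  by have := tot i; rewrite (octahedron_total i oU) (octahedron_total i oV) sz nn;
    lia.
apply/allP => d; rewrite mem_cat => dUV /=.
have [i di] : exists i, d = spike c 1 i \/ d = spike c (- 1) i.
  by case/orP: dUV => [/oU|/oV].
case: di => ->; [have := pp i | have := nn i]; rewrite /vcount => -[->] //.
Qed.

Lemma valid_admissible N x : valid N x -> admissible N x.1.
Proof.
by case=> bx _ hx; split=> //; exists ((height x.1 - N) %/ 2)%Z; lia.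
Qed.

Section Octahedron.
Variables (N : int) (E : seq profile -> seq profile -> Prop).
Hypothesis cE : congruence N E.

(** Each trade of antipodal pairs decreases it, and it is 0 when the flows of
    two families in the octahedron agree up to order. *)
Definition mismatch c (s t : seq profile) : int :=
  `|vcount c (- 1) (flows s) v0 - vcount c (- 1) (flows t) v0| +
  `|vcount c (- 1) (flows s) v1 - vcount c (- 1) (flows t) v1| +
  `|vcount c (- 1) (flows s) v2 - vcount c (- 1) (flows t) v2|.

Lemma perm_vcount c s U V i : perm_eq U V -> vcount c s U i = vcount c s V i.
Proof. by move=> /permP UV; rewrite /vcount UV. Qed.

Lemma vcount_gt0 c s U i : 0 < vcount c s U i -> spike c s i \in U.
Proof. by rewrite /vcount ltz_nat -has_count has_pred1. Qed.

Lemma allvalid_loops_ge0 s i : allvalid N s -> 0 <= total (loops s) i.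
Proof.
move=> vs; rewrite /total big_map big_seq; apply: sumr_ge0 => z zs.
by have [] := vs z zs.
Qed.

(** Trading the antipodal pair of direction j for the one of direction i costs
    a loop of direction i if c = 0. By [align_head] the loops of x can be
    chosen at will, so x can be given such a loop whenever the family has
    one. *)
Lemma gather c s i j : allvalid N s -> in_octahedron c (flows s) -> i != j ->
  0 < vcount c (- 1) (flows s) j -> 0 < vcount c 1 (flows s) j ->
  (c = 0 -> 0 < total (loops s) i) ->
  exists x y r, [/\ E s (x :: y :: r), allvalid N (x :: y :: r),
    perm_eq (flows s) (flows (x :: y :: r)) /\ backs s =1 backs (x :: y :: r),
    x.1 = spike c (- 1) j /\ y.1 = spike c 1 j & c = 0 -> 0 < entry x.2 i].
Proof.
move=> vs os ij nj pj avail.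
have [x [xs xj]] : exists x : profile, x \in s /\ x.1 = spike c (- 1) j.
  by have /mapP [x xs xj] := vcount_gt0 nj; exists x.
have ps := perm_to_rem xs; have vs' := perm_allvalid ps vs.
have vx := vs x xs; have [bx x0 xN] := vx.
(* The loops that x is to receive. *)
have [m [hm m0 mi mle]] : exists m, [/\ height m = height x.2, forall k,
  0 <= entry m k,
    c = 0 -> 0 < entry m i & forall k, entry m k <= total (loops s) k].
  have [c0|c0] := eqVneq c 0; last first.
    exists x.2; split=> // [c00|k]; first by rewrite c00 eqxx in c0.
    rewrite (perm_loops k ps) loops_cons total_cons.
    have := @allvalid_loops_ge0 (rem x s) k; rewrite lerDl; apply.
    by move=> z zs; apply: vs'; rewrite inE zs orbT.
  have [z zs zi] := loops_pos_mem (avail c0).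
  have [bz z0 zN] := vs z zs.
  have hz : height z.2 = height x.2.
    have [k dz] : exists k, z.1 = spike c 1 k \/ z.1 = spike c (- 1) k.
      by apply: os; apply: map_f.
    move: zN xN; rewrite xj; case: dz => ->; rewrite !height_spike c0; lia.
  exists z.2; split=> // k; rewrite (perm_loops k (perm_to_rem zs)) loops_cons
    total_cons.
  rewrite lerDl; apply: allvalid_loops_ge0.
  by move=> w ws; apply: vs; apply: mem_rem ws.
pose x1 : profile := (x.1, m).
have vx1 : valid N x1 by split=> //=; rewrite hm.
have le1 k : entry x1.2 k <= total (loops (x :: rem x s)) k
  by rewrite -(perm_loops k ps).
have [|t [Et vt pt bt]] := align_head cE (n :=
  `|dist x.2 x1.2|%N) _ vs' vx1 (erefl _) le1.
  by rewrite abszE ler_norm.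
have p1 : perm_eq (flows s) (spike c (- 1) j :: flows t).
  by apply: (perm_trans (perm_flows ps)); rewrite flows_cons xj perm_cons.
have [y [yt yj]] : exists y : profile, y \in t /\ y.1 = spike c 1 j.
  have : 0 < vcount c 1 (flows t) j.
    by move: pj; rewrite (perm_vcount _ _ _ p1) vcount_cons spike_eq.
  by case/vcount_gt0/mapP => y yt yj; exists y.
have pt1 := perm_to_rem yt.
have pxt : perm_eq (x1 :: t) (x1 :: y :: rem y t) by rewrite perm_cons.
exists x1, y, (rem y t); split=> //.
- apply: (congr_trans cE (congr_perm cE ps)); apply: (congr_trans cE Et).
  exact: (congr_perm cE).
- apply: (perm_allvalid pxt) => z; rewrite inE => /orP [/eqP -> //|]; exact: vt.
- split; last by move=> k; rewrite (perm_backs k ps) bt (perm_backs k pxt).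
  apply: (perm_trans p1); rewrite flows_cons -[x1.1]/(x.1) xj perm_cons;
    exact: perm_flows.
Qed.

(** If the multiplicities of the lower vertices are not all equal, one
    direction i is too rare and one direction j too frequent in s. As the
    differences of antipodal multiplicities agree, s contains the antipodal
    pair of direction j, and it can be traded for that of direction i. For c =
    0 the loop of direction i needed for the trade exists: s and t have equally
    many steps against this direction, and fewer of them are due to the flows
    in s. *)
Lemma octahedron_step c s t : allvalid N s -> allvalid N t ->
  in_octahedron c (flows s) -> in_octahedron c (flows t) -> same_sums s t ->
    0 < mismatch c s t ->
  exists u, [/\ E s u, allvalid N u, in_octahedron c (flows u), same_sums s u &
                mismatch c u t < mismatch c s t].
Proof.
move=> vs vt os ot [[szst totst] bst] gap.
have nonneg e U k : 0 <= vcount c e U k by [].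
have tot k : vcount c 1 (flows s) k - vcount c (- 1) (flows s) k =
             vcount c 1 (flows t) k - vcount c (- 1) (flows t) k.
  by have := totst k; rewrite (octahedron_total k os) (octahedron_total k ot)
    szst; lia.
have szs := octahedron_size os; have szt := octahedron_size ot; rewrite szst in szs.
have [i ni] : exists i, vcount c (- 1) (flows s) i < vcount c (- 1) (flows t) i.
  have: [|| vcount c (- 1) (flows s) v0 < vcount c (- 1) (flows t) v0,
    vcount c (- 1) (flows s) v1 < vcount c (- 1) (flows t) v1
     | vcount c (- 1) (flows s) v2 < vcount c (- 1) (flows t) v2].
    move: gap (tot v0) (tot v1) (tot v2) szs szt; rewrite /mismatch; lia.
  by case/or3P => ?; [exists v0|exists v1|exists v2].
have [j nj] : exists j, vcount c (- 1) (flows t) j < vcount c (- 1) (flows s) j.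
  have: [|| vcount c (- 1) (flows t) v0 < vcount c (- 1) (flows s) v0,
    vcount c (- 1) (flows t) v1 < vcount c (- 1) (flows s) v1
     | vcount c (- 1) (flows t) v2 < vcount c (- 1) (flows s) v2].
    move: gap (tot v0) (tot v1) (tot v2) szs szt; rewrite /mismatch; lia.
  by case/or3P => ?; [exists v0|exists v1|exists v2].
have ij : i != j by apply: contraTneq ni => ->; rewrite -leNgt ltW.
have nj0 : 0 < vcount c (- 1) (flows s) j by move: (nonneg (- 1) (flows t) j); lia.
have pj0 : 0 < vcount c 1 (flows s) j by move: (nonneg 1 (flows t) j) (tot j); lia.
have avail : c = 0 -> 0 < total (loops s) i.
  move=> c0; have := bst i; rewrite !backsE; move: os ot ni.
  rewrite c0 => os ot ni; rewrite !octahedron_negs //.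
  by have := allvalid_loops_ge0 i vt; lia.
have [x [y [r [Esx vxy [pf bxy] [xj yj] xi]]]] := gather vs os ij nj0 pj0 avail.
have vx : valid N x by apply: vxy; rewrite mem_head.
have vy : valid N y by apply: vxy; rewrite inE mem_head orbT.
have vr : allvalid N r by move=> z zr; apply: vxy; rewrite !inE zr !orbT.
(* For c = 0 the steps freed by the pair of direction j become a loop of
   direction j, and a loop of direction i is used up. *)
pose m := if c == 0 then move_unit i j x.2 else x.2.
pose x1 : profile := (spike c (- 1) i, m); pose y1 : profile := (spike c 1 i, y.2).
have vx1 : valid N x1.
  have [bx x0 xN] := vx; split=> /=.
  - by rewrite balancedE !entry_vec_of; move: i {ij ni avail xi m x1 y1};
    apply: forall_I3 => /=; lia.
  - move=> k; rewrite /m; case: eqP => // c0; rewrite entry_vec_of;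
    have := xi c0; have := x0 k.
    by case: (k =P i) => [->|_]; lia.
  - move: xN; rewrite xj !height_spike /m; case: eqP => _ //;
    by rewrite height_move_unit.
have vy1 : valid N y1.
  have [by_ y0 yN] := vy; split=> //=; last by move: yN; rewrite yj !height_spike.
  by rewrite balancedE !entry_vec_of; move: i {ij ni avail xi m x1 vx1 y1};
    apply: forall_I3 => /=; lia.
have eq1 k : entry x1.1 k + entry y1.1 k = entry x.1 k + entry y.1 k.
  by rewrite xj yj /= !entry_vec_of; lia.
have eq2 k : back x1 k + back y1 k = back x k + back y k.
  rewrite /back xj yj /= /neg !entry_vec_of /m; case: (c =P 0) => [->|c0].
    rewrite entry_vec_of; case: (k =P i) => _; case: (k =P j) => _ /=; lia.
  by case: (k =P i) => _; case: (k =P j) => _ /=; lia.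
exists (x1 :: y1 :: r); split.
- by apply: (congr_trans cE Esx); apply: (congr_pair cE).
- by move=> z; rewrite !inE => /or3P [/eqP ->|/eqP ->|/vr].
- move=> d; rewrite !flows_cons !inE => /or3P [/eqP ->|/eqP ->|dr].
  + by exists i; right.
  + by exists i; left.
  + by apply: os; rewrite (perm_mem pf) !flows_cons !inE dr !orbT.
- apply: (@same_sums_trans _ (x :: y :: r)); last exact: same_sums_pair.
  split; last exact: bxy.
  by split=> [|k]; [apply: perm_size pf | apply: perm_total pf].
- have ns k : vcount c (- 1) (flows s) k =
  vcount c (- 1) (flows (x1 :: y1 :: r)) k - (i == k)%:Z + (j == k)%:Z.
    by rewrite (perm_vcount _ _ _ pf) !flows_cons !vcount_cons xj yj /= !spike_eq
      //=; lia.
  move: ni nj ij ns; rewrite /mismatch.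
  move: (vcount c (- 1) (flows (x1 :: y1 :: r))) (vcount c (- 1) (flows t))
    (vcount c (- 1) (flows s)).
  clear=> f g h + + + ns; rewrite !ns; clear ns.
  by move: i j; apply: forall_I3; apply: forall_I3 => //=; lia.
Qed.

Lemma octahedron_connected c s t : allvalid N s -> allvalid N t ->
  in_octahedron c (flows s) -> in_octahedron c (flows t) -> same_sums s t -> E s t.
Proof.
have [n] := ubnP `|mismatch c s t|%N; elim: n s => // n IH s sn vs vt os ot st.
have [gap0|gap] := leP (mismatch c s t) 0.
  have pf : perm_eq (flows s) (flows t).
    apply: (octahedron_perm os ot st.1); move: gap0; rewrite /mismatch => gap0.
    by apply: forall_I3; lia.
  exact: (align cE vs vt pf st.2).
have [u [Esu vu ou su gu]] := octahedron_step vs vt os ot st gap.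
apply: (congr_trans cE Esu); apply: IH => //.
  by move: sn gu; rewrite /mismatch; lia.
exact: same_sums_trans (same_sums_sym su) st.
Qed.

Theorem connected s t : allvalid N s -> allvalid N t -> same_sums s t -> E s t.
Proof.
move=> vs vt st.
have [s' [Es vs' ss sts]] := descend cE vs.
have [t' [Et vt' tt stt]] := descend cE vt.
have st' : same_sums s' t'.
  by apply: same_sums_trans tt; apply: same_sums_trans st; apply: same_sums_sym.
apply: (congr_trans cE Es); apply: (congr_trans cE _ (congr_sym cE Et)).
have adm d : d \in flows s' ++ flows t' -> admissible N d.
  by rewrite mem_cat => /orP [] /mapP [x xs ->]; apply: valid_admissible;
    [apply: vs'|apply: vt'].
have [pf|[c oc]] := stable_unique st'.1 sts stt adm.
  exact: (align cE vs' vt' pf st'.2).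
apply: (octahedron_connected (c := c)) => // d dU; apply: oc;
  rewrite mem_cat dU ?orbT //.
Qed.
End Octahedron.

(** * Walks on three states *)

Definition next (i : 'I_3) : 'I_3 :=
  match val i with 0%N => v1 | 1%N => v2 | _ => v0 end.
Definition prev (i : 'I_3) : 'I_3 := next (next i).

Definition steps (s : seq 'I_3) (i j : 'I_3) : nat :=
  count_mem (i, j) (zip s (behead s)).

Lemma steps_cons x y s i j :
  steps (x :: y :: s) i j = ((x == i) && (y == j) + steps (y :: s) i j)%N.
Proof. by rewrite /steps /= xpair_eqE. Qed.

Lemma nextE : (next v0 = v1) * (next v1 = v2) * (next v2 = v0) *
  (prev v0 = v2) * (prev v1 = v0) * (prev v2 = v1).
Proof. by []. Qed.

Lemma eq_I3 : ((v0 == v0) = true) * ((v0 == v1) = false) * ((v0 == v2) = false) *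
  ((v1 == v0) = false) * ((v1 == v1) = true) * ((v1 == v2) = false) *
  ((v2 == v0) = false) * ((v2 == v1) = false) * ((v2 == v2) = true).
Proof. by []. Qed.

(** The hypothesis is that out-degree and in-degree of each state differ as for
    a walk from s to t, and that the walk can start at s. A first step along
    one of the two arcs leaving s can fail only by arriving at t with no arc
    left there; then all remaining arcs join the other two states, and the
    other first step works. *)
Lemma euler n (F B : 'I_3 -> nat) (s t : 'I_3) :
  (F v0 + F v1 + F v2 + B v0 + B v1 + B v2 = n)%N ->
  (forall v, F v + B (prev v) + (v == t) = F (prev v) + B v + (v == s))%N ->
  (n = 0 \/ 0 < F s + B (prev s))%N ->
  exists l, [/\ path [rel i j | i != j] s l, last s l = t, size l = n &
    forall i, steps (s :: l) i (next i) = F i /\ steps (s :: l) (next i) i = B i].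
Proof.
elim: n F B s => [|n IH] F B s sumn flow start.
  exists [::]; split=> //=; last by apply: forall_I3; rewrite /steps /=; lia.
  apply/eqP; move: (flow v0) (flow v1) (flow v2);
  by move: s t {flow start}; apply: forall_I3; apply: forall_I3;
    rewrite ?nextE ?eq_I3 /=; lia.
have {}start : (0 < F s + B (prev s))%N by case: start.
pose F' i := (F i - (i == s))%N; pose B' i := (B i - (i == prev s))%N.
(* One of the two arcs leaving s can be removed without stranding the walk. *)
have [[Fs ok]|[Bs ok]] :
   (0 < F s)%N /\ (n = 0 \/ 0 < F' (next s) + B (prev (next s)))%N \/
   (0 < B (prev s))%N /\ (n = 0 \/ 0 < F (prev s) + B' (prev (prev s)))%N.
  have := flow v0; have := flow v1; have := flow v2; move: sumn start.
  rewrite /F' /B'; clear.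
  by move: s t; apply: forall_I3; apply: forall_I3; rewrite ?nextE ?eq_I3 /=; lia.
- have [|v||l [pl ll sl nl]] := IH F' B (next s).
  + by move: sumn Fs; rewrite /F'; clear; move: s; apply: forall_I3;
    rewrite ?nextE ?eq_I3 /=; lia.
  + have := flow v; move: Fs; rewrite /F'; clear.
    by move: s t v; apply: forall_I3; apply: forall_I3; apply: forall_I3;
      rewrite ?nextE ?eq_I3 /=; lia.
  + exact: ok.
  exists (next s :: l); split => //=.
  + by rewrite pl andbT; move: s {sumn flow start F' B' Fs ok pl ll nl};
    apply: forall_I3.
  + by rewrite sl.
  + move=> i; have [ni1 ni2] := nl i; rewrite !steps_cons ni1 ni2 /F'.
    move: Fs; clear; move: i s; apply: forall_I3; apply: forall_I3;
      rewrite ?nextE ?eq_I3 /=; lia.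
- have [|v||l [pl ll sl nl]] := IH F B' (prev s).
  + by move: sumn Bs; rewrite /B'; clear; move: s; apply: forall_I3;
    rewrite ?nextE ?eq_I3 /=; lia.
  + have := flow v; move: Bs; rewrite /B'; clear.
    by move: s t v; apply: forall_I3; apply: forall_I3; apply: forall_I3;
      rewrite ?nextE ?eq_I3 /=; lia.
  + exact: ok.
  exists (prev s :: l); split => //=.
  + by rewrite pl andbT; move: s {sumn flow start F' B' Bs ok pl ll nl};
    apply: forall_I3.
  + by rewrite sl.
  + move=> i; have [ni1 ni2] := nl i; rewrite !steps_cons ni1 ni2 /B'.
    move: Bs; clear; move: i s; apply: forall_I3; apply: forall_I3;
      rewrite ?nextE ?eq_I3 /=; lia.
Qed.

Definition forth_steps (s : seq 'I_3) i : int := (steps s i (next i))%:Z.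
Definition back_steps (s : seq 'I_3) i : int := (steps s (next i) i)%:Z.

Definition profile_of (s : seq 'I_3) : profile :=
  (vec_of (fun i => forth_steps s i - back_steps s i),
   vec_of (fun i => Num.min (forth_steps s i) (back_steps s i))).

Lemma back_profile_of s i : back (profile_of s) i = back_steps s i.
Proof. by rewrite /back /neg !entry_vec_of; lia. Qed.

Lemma flow_profile_of s i : entry (profile_of s).1 i =
  forth_steps s i - back_steps s i.
Proof. exact: entry_vec_of. Qed.

(** Each visit enters and leaves a state, except at the two ends. *)
Lemma walk_flow x l v : path [rel i j | i != j] x l ->
  (steps (x :: l) v (next v) + steps (x :: l) v (prev v) + (v == last x l) =
   steps (x :: l) (prev v) v + steps (x :: l) (next v) v + (v == x))%N.
Proof.
elim: l x => [|y l IH] x /=; first by rewrite /steps.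
case/andP=> xy /IH; rewrite !steps_cons; move: xy.
move: (steps _ v (next v)) (steps _ v (prev v)) (steps _ (next v) v) (steps _
  (prev v) v) => a b c d.
move: (last y l) => z; clear.
by move: v x y; apply: forall_I3; apply: forall_I3; apply: forall_I3;
  rewrite ?nextE ?eq_I3 //=; lia.
Qed.

Lemma walk_size x l : path [rel i j | i != j] x l ->
  (size l = steps (x :: l) v0 v1 + steps (x :: l) v1 v2 + steps (x :: l) v2 v0 +
            steps (x :: l) v1 v0 + steps (x :: l) v2 v1 + steps (x :: l) v0 v2)%N.
Proof.
elim: l x => [|y l IH] x //= /andP [xy /IH ->]; rewrite !steps_cons.
move: xy;
by move: x y {IH}; apply: forall_I3; apply: forall_I3; rewrite ?nextE ?eq_I3 //=;
  lia.
Qed.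

Lemma height_abs d : balanced d ->
  `|height d| = `|entry d v0| + `|entry d v1| + `|entry d v2|.
Proof.
by move=> bd; case: {bd} d / (balanced_cases bd) => k; rewrite /height /entry /=;
  lia.
Qed.

Lemma profile_of_valid x l : path [rel i j | i != j] x l ->
  valid (size l) (profile_of (x :: l)).
Proof.
move=> pl; have bal : balanced (profile_of (x :: l)).1.
  rewrite balancedE !flow_profile_of /forth_steps /back_steps.
  have := walk_flow v0 pl; have := walk_flow v1 pl; have := walk_flow v2 pl.
  move: (last x l) (steps (x :: l)) => z st; clear; move: x z.
  by apply: forall_I3; apply: forall_I3; rewrite ?nextE ?eq_I3 /=; lia.
split=> // [i|]; first by rewrite entry_vec_of /forth_steps /back_steps; lia.
rewrite height_abs // (walk_size pl) !flow_profile_of /height !entry_vec_of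
  /forth_steps /back_steps.
by move: (steps (x :: l)) => st; rewrite !nextE; lia.
Qed.

(** A balanced flow is constant up to one entry that is larger or smaller by 1:
    it is the flow of a closed walk, or of a walk along or against that
    edge. *)
Lemma profile_of_surj (n : nat) (p : profile) : valid n p ->
  exists x l, [/\ path [rel i j | i != j] x l, size l = n &
    profile_of (x :: l) = p].
Proof.
case: p => d m [/= bd m0 hn].
pose B i := absz (neg d i + entry m i);
  pose F i := absz (entry d i + neg d i + entry m i).
have BE i : (B i)%:Z = neg d i + entry m i by rewrite /B; move: (m0 i);
  rewrite /neg; lia.
have FE i : (F i)%:Z = entry d i + neg d i + entry m i.
  by rewrite /F; move: (m0 i); rewrite /neg; lia.
have sumn : (F v0 + F v1 + F v2 + B v0 + B v1 + B v2 = n)%N.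
  move: (FE v0) (FE v1) (FE v2) (BE v0) (BE v1) (BE v2) hn.
  by rewrite (height_abs bd) /neg /height; lia.
(* Any state with an outgoing arc if the flow is constant, otherwise the ends of
   the exceptional edge. *)
have [s [t [flow start]]] : exists s t,
  (forall v, F v + B (prev v) + (v == t) = F (prev v) + B v + (v == s))%N /\
  (n = 0 \/ 0 < F s + B (prev s))%N.
  have dE i : entry d i = (F i)%:Z - (B i)%:Z by rewrite BE FE; lia.
  move: dE sumn; clear -bd; move: F B.
  case: {bd} d / (kind_cases bd) => [k|k i|k i] F B dE sumn.
  - have [n0|n0] := posnP n.
      by exists v0, v0; split; [apply: forall_I3; rewrite ?nextE; lia | left].
    have [s hs] : exists s, (0 < F s + B (prev s))%N.
      have: [|| 0 < F v0 + B v2, 0 < F v1 + B v0 | 0 < F v2 + B v1]%N by lia.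
      by case/or3P => ?; [exists v0 | exists v1 | exists v2].
    exists s, s; split; last by right.
    move: (dE v0) (dE v1) (dE v2); rewrite !entry_vec_of => e0 e1 e2.
    by apply: forall_I3; rewrite ?nextE; lia.
  - exists i, (next i); move: (dE v0) (dE v1) (dE v2);
    rewrite !entry_vec_of => e0 e1 e2.
    split; last by right; move: i e0 e1 e2 {dE}; apply: forall_I3;
      rewrite ?nextE ?eq_I3 /=; lia.
    move=> v;  move: i v e0 e1 e2 {dE}.
  by apply: forall_I3; apply: forall_I3; rewrite ?nextE ?eq_I3 /=; lia.
  - exists (next i), i; move: (dE v0) (dE v1) (dE v2);
    rewrite !entry_vec_of => e0 e1 e2.
    split; last by right; move: i e0 e1 e2 {dE}; apply: forall_I3;
      rewrite ?nextE ?eq_I3 /=; lia.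
    move=> v;  move: i v e0 e1 e2 {dE}.
  by apply: forall_I3; apply: forall_I3; rewrite ?nextE ?eq_I3 /=; lia.
have [l [pl _ sl nl]] := euler sumn flow start.
exists s, l; split=> //; congr (_, _); apply: vec_ext => i;
  rewrite entry_vec_of /forth_steps /back_steps (nl i).1 (nl i).2 FE BE /neg; lia.
Qed.

(** * From fibres to the ideal *)

Section Ideal.
Variables (R : comNzRingType) (G : R -> Prop).

Lemma ideal0 : generated_ideal G 0.
Proof. by exists 0%N, (fun=> 0), (fun=> 0); split=> [[]//|]; rewrite big_ord0. Qed.

Lemma ideal_gen g : G g -> generated_ideal G g.
Proof.
by move=> Gg; exists 1%N, (fun=> 1), (fun=> g); split=> //; rewrite big_ord1 mul1r.
Qed.

Lemma idealM a p : generated_ideal G p -> generated_ideal G (a * p).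
Proof.
case=> n [b [g [Gg ->]]]; exists n, (fun i => a * b i), g; split=> //.
by rewrite mulr_sumr; apply: eq_bigr => i _; rewrite mulrA.
Qed.

Lemma idealD p q : generated_ideal G p -> generated_ideal G q ->
  generated_ideal G (p + q).
Proof.
case=> n [a [g [Gg ->]]] [m [b [h [Gh ->]]]].
exists (n + m)%N.
exists (fun i => match split i with inl j => a j | inr j => b j end).
exists (fun i => match split i with inl j => g j | inr j => h j end).
split=> [i|]; first by case: (split i).
rewrite big_split_ord /=; congr (_ + _); apply: eq_bigr => i _.
  by rewrite (unsplitK (inl i)).
by rewrite (unsplitK (inr i)).
Qed.

Lemma ideal_sum (I : eqType) (r : seq I) (F : I -> R) :
  (forall i, i \in r -> generated_ideal G (F i)) ->
    generated_ideal G (\sum_(i <- r) F i).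
Proof.
elim: r => [|i r IH] h; first by rewrite big_nil; apply: ideal0.
rewrite big_cons; apply: idealD; first by apply: h; rewrite mem_head.
by apply: IH => j jr; apply: h; rewrite inE jr orbT.
Qed.

End Ideal.

Lemma mpolyX_sum (K : fieldType) n (I : Type) (r : seq I) (F : I -> 'X_{1..n}) :
  'X_[(\sum_(i <- r) F i)%MM] = \prod_(i <- r) 'X_[F i] :> {mpoly K[n]}.
Proof. by apply: (big_morph _ (@mpolyXD _ _)); apply: mpolyX0. Qed.

Section Chain.
Variables (K : fieldType) (T : nat).
Notation W := (word 3 T).

(** The exponent of the image of a variable. *)
Definition arcs (w : W) : 'X_{1..#|{: word 3 2}|} :=
  (\sum_(j < T.-1) U_(enum_rank (step w j)))%MM.

Definition arcsum (s : seq W) := (\sum_(w <- s) arcs w)%MM.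

Lemma arcsum_cons w s : arcsum (w :: s) = (arcs w + arcsum s)%MM.
Proof. exact: big_cons. Qed.

Definition monomial (s : seq W) : word_ring K 3 T := \prod_(w <- s) word_var K w.

Lemma monomial_cons w s : monomial (w :: s) = word_var K w * monomial s.
Proof. exact: big_cons. Qed.

Lemma Phi_var w : Phi (word_var K w) = 'X_[arcs w].
Proof.
rewrite /Phi /word_var mmapX mmap1U enum_rankK /word_var.
by rewrite /arcs mpolyX_sum.
Qed.

Lemma PhiB (p q : word_ring K 3 T) : Phi (p - q) = Phi p - Phi q.
Proof. exact: mmapB. Qed.

Lemma PhiM (p q : word_ring K 3 T) : Phi (p * q) = Phi p * Phi q.
Proof. by rewrite /Phi rmorphM. Qed.

Lemma Phi_sum I (r : seq I) (F : I -> word_ring K 3 T) :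
  Phi (\sum_(i <- r) F i) = \sum_(i <- r) Phi (F i).
Proof. by rewrite /Phi raddf_sum. Qed.

Lemma Phi_monomial s : Phi (monomial s) = 'X_[arcsum s].
Proof.
elim: s => [|w s IH]; last
  by rewrite monomial_cons PhiM IH Phi_var arcsum_cons mpolyXD.
by rewrite /monomial /arcsum !big_nil /Phi rmorph1 mpolyX0.
Qed.

Definition words_of (m : 'X_{1..#|{: W}|}) : seq W :=
  flatten [seq nseq (m i) (enum_val i) | i <- enum 'I_#|{: W}|].

Lemma monomial_words_of m : monomial (words_of m) = 'X_[m].
Proof.
rewrite /monomial /words_of big_flatten big_map big_enum /= [in RHS](multinomUE_id
  m) mpolyX_sum.
apply: eq_bigr => i _; rewrite -mpolyXn big_nseq /word_var enum_valK.
by elim: (m i) => [|k IH]; rewrite ?expr0 // exprS /= IH.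
Qed.

(** The exponent of the image of a monomial. *)
Definition target (m : 'X_{1..#|{: W}|}) := arcsum (words_of m).

Lemma Phi_X m : Phi ('X_[m] : word_ring K 3 T) = 'X_[target m].
Proof. by rewrite -monomial_words_of Phi_monomial. Qed.

Lemma PhiE (p : word_ring K 3 T) : Phi p =
  \sum_(m <- msupp p) p@_m *: 'X_[target m].
Proof.
rewrite {1}[p]mpolyE Phi_sum; apply: eq_bigr => m _.
by rewrite /Phi mmapZ -Phi_X mul_mpolyC.
Qed.

Lemma mdeg_arcs w : mdeg (arcs w) = T.-1.
Proof.
rewrite /arcs mdeg_sum (eq_bigr (fun=> 1%N)) => [|j _]; last exact: mdeg1.
by rewrite sum1_card card_ord.
Qed.

Lemma mdeg_arcsum s : mdeg (arcsum s) = (size s * T.-1)%N.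
Proof.
elim: s => [|w s IH]; first by rewrite /arcsum big_nil mdeg0.
by rewrite arcsum_cons mdegD IH mdeg_arcs.
Qed.

(** Taking all elements of bounded degree, and not only binomials, makes this
    the largest candidate for a generating set. *)
Definition bounded_degree (d : nat) (g : word_ring K 3 T) :=
  markov_chain_ideal g /\ (mpoly_degree g <= d)%N.

Definition equiv (s t : seq W) :=
  generated_ideal (bounded_degree 2) (monomial s - monomial t).

Lemma msize_monomial s : msize (monomial s) = (size s).+1.
Proof.
have [m -> dm] : exists2 m, monomial s = 'X_[m] & mdeg m = size s.
  elim: s => [|w s [m IH dm]].
    by exists 0%MM; rewrite ?mdeg0 // /monomial big_nil mpolyX0.
  exists (U_(enum_rank w) + m)%MM; last by rewrite mdegD mdeg1 dm.
  by rewrite monomial_cons IH mpolyXD.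
by rewrite msizeX dm.
Qed.

Lemma binomial_low s t : arcsum s = arcsum t -> (size s <= 2)%N ->
  (size t <= 2)%N ->
  bounded_degree 2 (monomial s - monomial t).
Proof.
move=> st s2 t2; split; first
  by rewrite /markov_chain_ideal PhiB !Phi_monomial st subrr.
have : (msize (monomial s - monomial t) <= 3)%N.
  rewrite (leq_trans (mmeasureD_le _ _ _)) // mmeasureN !msize_monomial.
  by rewrite geq_max !ltnS s2 t2.
by rewrite /mpoly_degree; case: (msize _).
Qed.

Lemma equiv_perm s t : perm_eq s t -> equiv s t.
Proof. by move=> st; rewrite /equiv /monomial (perm_big _ st) subrr;
  apply: ideal0. Qed.

Lemma equiv_refl s : equiv s s.
Proof. exact: equiv_perm. Qed.

Lemma equiv_sym s t : equiv s t -> equiv t s.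
Proof. by move/(idealM (- 1)); rewrite mulN1r opprB. Qed.

Lemma equiv_trans s t u : equiv s t -> equiv t u -> equiv s u.
Proof. by move=> st /(idealD st); rewrite addrA subrK. Qed.

Lemma equiv_cat r s t : equiv s t -> equiv (r ++ s) (r ++ t).
Proof. by move/(idealM (monomial r));
  rewrite mulrBr /equiv /monomial !big_cat.  Qed.

Lemma equiv_small r s t : arcsum s = arcsum t -> (size s <= 2)%N ->
  (size t <= 2)%N ->
  equiv (s ++ r) (t ++ r).
Proof.
move=> st s2 t2.
apply: (equiv_trans (equiv_perm (permEl (perm_catC s r)))).
apply: equiv_trans (equiv_perm (permEl (perm_catC r t))).
by apply: equiv_cat; apply: ideal_gen; apply: binomial_low.
Qed.

(** Replacing each monomial of p by a fixed representative of its fibre changes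
    p by an element of the ideal generated by the quadrics. The result is zero,
    since its coefficients are those of the image of p. *)
Lemma ideal_of_fibers :
  (forall s t, arcsum s = arcsum t -> equiv s t) ->
  forall p : word_ring K 3 T, Phi p = 0 -> generated_ideal (bounded_degree 2) p.
Proof.
move=> fib p p0.
(* The list contains m whenever m is a monomial of p, so that [head] never
   returns its default value there. *)
pose r m := head m [seq m' <- msupp p | target m' == target m].
have r_image m : m \in msupp p -> target (r m) = target m.
  move=> mp; have : m \in [seq m' <- msupp p | target m' == target m].
    by rewrite mem_filter eqxx.
  rewrite /r; case E: [seq _ <- _ | _] => [|x l] // _.
  have : x \in [seq m' <- msupp p | target m' == target m] by rewrite E mem_head.
  by rewrite mem_filter => /andP [/eqP].
have r_eq m m' : m \in msupp p -> m' \in msupp p ->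
  (r m == r m') = (target m == target m').
  move=> mp mp'; apply/eqP/eqP => [E|E]; first by rewrite -r_image // E r_image.
  have : m \in [seq x <- msupp p | target x == target m] by rewrite mem_filter eqxx.
  by rewrite /r E; case: [seq _ <- _ | _].
have -> : p = \sum_(m <- msupp p) p@_m *: ('X_[m] - 'X_[r m]).
  rewrite (eq_bigr (fun m => p@_m *: 'X_[m] - p@_m *: 'X_[r m])) => [|m _];
    last exact: scalerBr.
  rewrite sumrB -mpolyE [X in _ - X](_ : _ = 0) ?subr0 //.
  apply/mpolyP => k; rewrite raddf_sum mcoeff0 /=.
  have [/hasP [m0 m0p /eqP <-]|no] := boolP (has (fun m => r m == k) (msupp p)).
    transitivity ((Phi p)@_(target m0)); last by rewrite p0 mcoeff0.
    rewrite PhiE raddf_sum /=; apply: eq_big_seq => m mp.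
    by rewrite !mcoeffZ !mcoeffX r_eq.
  rewrite big_seq big1 // => m mp; rewrite mcoeffZ mcoeffX.
  by rewrite (negbTE (hasPn no m mp)) mulr0.
apply: ideal_sum => m mp; rewrite -mul_mpolyC; apply: idealM.
by rewrite -!monomial_words_of; apply: fib; apply/esym/r_image.
Qed.

End Chain.

(** * Words and their profiles *)

Lemma stepE T (w : word 3 T) (j : 'I_T.-1) (e : word 3 2) :
  (step w j == e) =
  (nth v0 (letters w) j == tnth e ord0) &&
    (nth v0 (letters w) j.+1 == tnth e ord_max).
Proof.
apply/eqP/andP => [<-|[/eqP h1 /eqP h2]].
  by rewrite !(tnth_nth v0) /= !(tnth_nth v0).
apply/val_inj/eq_from_tnth => i /=.
have [->|->] : i = ord0 \/ i = ord_max.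
- by case: i => [[|[|//]] lti]; [left|right]; apply: val_inj.
- by rewrite -h1 !(tnth_nth v0) /= (tnth_nth v0).
- by rewrite -h2 !(tnth_nth v0) /= (tnth_nth v0).
Qed.

Lemma steps_sum (s : seq 'I_3) i j :
  steps s i j = (\sum_(k < (size s).-1) ((nth v0 s k == i) &&
    (nth v0 s k.+1 == j)))%N.
Proof.
have szz : size (zip s (behead s)) = (size s).-1.
  by rewrite size_zip size_behead; lia.
rewrite /steps -sum1_count (big_nth (v0, v0)) szz big_mkord big_mkcond /=.
apply: eq_bigr => k _; rewrite nth_zip_cond szz ltn_ord nth_behead xpair_eqE.
by case: ifP.
Qed.

Lemma arcsE T (w : word 3 T) (e : word 3 2) :
  arcs w (enum_rank e) = steps (letters w) (tnth e ord0) (tnth e ord_max).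
Proof.
rewrite /arcs mnm_sumE steps_sum size_tuple; apply: eq_bigr => j _.
by rewrite mnm1E (inj_eq enum_rank_inj) stepE.
Qed.

Lemma arcsum_steps T (s : seq (word 3 T)) (e : word 3 2) :
  arcsum s (enum_rank e) =
  (\sum_(w <- s) steps (letters w) (tnth e ord0) (tnth e ord_max))%N.
Proof. by rewrite /arcsum mnm_sumE; apply: eq_bigr => w _; rewrite arcsE. Qed.

Lemma arc_word (i j : 'I_3) : i != j ->
  exists e : word 3 2, tnth e ord0 = i /\ tnth e ord_max = j.
Proof.
move=> ij; have se : sorted [rel i j | i != j] [tuple i; j] by rewrite /= ij.
by exists (Word se); rewrite !(tnth_nth v0).
Qed.

Lemma arc_cases (e : word 3 2) : exists i,
  tnth e ord0 = i /\ tnth e ord_max = next i \/ tnth e ord0 =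
    next i /\ tnth e ord_max = i.
Proof.
have : tnth e ord0 != tnth e ord_max.
  by case: e => [[[|a [|b []]] //= sz] /=]; rewrite andbT !(tnth_nth v0).
move: (tnth e ord0) (tnth e ord_max); apply: forall_I3; apply: forall_I3 => // _;
 by [exists v0; auto | exists v1; auto | exists v2; auto].
Qed.

Lemma arcsum_eq T (s t : seq (word 3 T)) :
  arcsum s = arcsum t <->
  (forall i, (\sum_(w <- s) steps (letters w) i (next i))%N =
             (\sum_(w <- t) steps (letters w) i (next i))%N /\
             (\sum_(w <- s) steps (letters w) (next i) i)%N =
             (\sum_(w <- t) steps (letters w) (next i) i)%N).
Proof.
split=> [st i|st].
  have ni : i != next i by move: i; apply: forall_I3.
  have ni' : next i != i by move: i {ni}; apply: forall_I3.
  have [e [e0 e1]] := arc_word ni; have [f [f0 f1]] := arc_word ni'.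
  have := congr1 (fun m : 'X_{1.._} => m (enum_rank e)) st.
  have := congr1 (fun m : 'X_{1.._} => m (enum_rank f)) st.
  by rewrite !arcsum_steps e0 e1 f0 f1.
apply/mnmP => k; rewrite -(enum_valK k) !arcsum_steps.
by have [i [[-> ->]|[-> ->]]] := arc_cases (enum_val k); have [] := st i.
Qed.

Definition profile_of_word T (w : word 3 T) : profile := profile_of (letters w).

Lemma flow_sum T (s : seq (word 3 T)) i :
  total (flows [seq profile_of_word w | w <- s]) i =
  (\sum_(w <- s) steps (letters w) i (next i))%N%:Z -
  (\sum_(w <- s) steps (letters w) (next i) i)%N%:Z.
Proof.
elim: s => [|w s IH]; first by rewrite /total !big_nil.
rewrite /= total_cons IH !big_cons flow_profile_of /forth_steps /back_steps; lia.
Qed.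

Lemma back_sum T (s : seq (word 3 T)) i :
  backs [seq profile_of_word w |
    w <- s] i = (\sum_(w <- s) steps (letters w) (next i) i)%N%:Z.
Proof.
elim: s => [|w s IH]; first by rewrite /backs !big_nil.
rewrite /= backs_cons IH !big_cons back_profile_of /back_steps; lia.
Qed.

Lemma arcsum_sums T (s t : seq (word 3 T)) : size s = size t ->
  arcsum s = arcsum t <-> same_sums [seq profile_of_word w |
    w <- s] [seq profile_of_word w | w <- t].
Proof.
move=> szst; rewrite arcsum_eq; split=> [st|[[_ tot] bst] i].
  split=> [|i]; last by rewrite !back_sum; case: (st i) => _ ->.
  by split=> [|i]; [rewrite !size_map | rewrite !flow_sum; case: (st i) => -> ->].
by move: (tot i) (bst i); rewrite !flow_sum !back_sum; lia.
Qed.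

Lemma profile_of_word_valid N (w : word 3 N.+1) : valid N (profile_of_word w).
Proof.
case: w => -[[//|x l] /= sz] pl.
have -> : N%:Z = (size l)%:Z by congr Posz; move/eqP: (sz) => [].
exact: profile_of_valid.
Qed.

Lemma profile_of_word_surj N (p : profile) : valid N%:Z p ->
  exists w : word 3 N.+1, profile_of_word w = p.
Proof.
case/profile_of_surj => x [l [pl sl pE]].
have sz : size (x :: l) == N.+1 by rewrite /= sl.
by exists (@Word 3 N.+1 (Tuple sz) pl).
Qed.

Lemma word_of_fun T (f : nat -> 'I_3) : (forall n, f n != f n.+1) ->
  {w : word 3 T | letters w = mkseq f T :> seq _}.
Proof.
move=> f_neq; have sz : size (mkseq f T) == T by rewrite size_mkseq.
have sf : sorted [rel i j | i != j] (Tuple sz).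
  apply/(sortedP v0) => n; rewrite /= size_mkseq => lt_nT.
  by rewrite !nth_mkseq // ltnW.
by exists (Word sf).
Qed.

Definition alternate (a b : 'I_3) (n : nat) : 'I_3 := if odd n then b else a.

Lemma alternate_neq a b n : a != b -> alternate a b n != alternate a b n.+1.
Proof. by rewrite /alternate /=; case: odd => //=; rewrite eq_sym. Qed.

Section Fibers.
Variables (K : fieldType) (N : nat).
Notation W := (word 3 N.+1).

Definition default_word : W :=
  sval (word_of_fun N.+1 (fun n => @alternate_neq v0 v1 n isT)).

(** A section of [profile_of_word], which transports moves of profiles to moves
    of words. *)
Definition word_of_profile (p : profile) : W :=
  odflt default_word [pick w | profile_of_word w == p].

Lemma word_of_profileK p : valid N p -> profile_of_word (word_of_profile p) = p.
Proof.
case/profile_of_word_surj => w wp; rewrite /word_of_profile;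
  case: pickP => [w' /eqP //|].
by move/(_ w); rewrite wp eqxx.
Qed.

Lemma equiv_cons (w : W) s t : equiv K s t -> equiv K (w :: s) (w :: t).
Proof. exact: (@equiv_cat K _ [:: w]). Qed.

Lemma equiv_representatives (s : seq W) :
  equiv K s [seq word_of_profile p | p <- [seq profile_of_word w | w <- s]].
Proof.
elim: s => [|w s IH] /=; first exact: equiv_refl.
apply: (equiv_trans (equiv_cons w IH)).
apply: (@equiv_small K _ _ [:: w] [:: _]) => //.
apply/arcsum_sums => //=; rewrite word_of_profileK;
  last exact: profile_of_word_valid.
exact: same_sums_refl.
Qed.

Lemma profile_congruence : congruence N
  (fun a b => equiv K (map word_of_profile a) (map word_of_profile b)).
Proof.
split=> [s t|s t u|s t st|x s t|x y x' y' s vx vy vx' vy' eq1 eq2].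
- exact: equiv_sym.
- exact: equiv_trans.
- by apply: equiv_perm; apply: perm_map.
- exact: equiv_cons.
apply: (@equiv_small K _ _ [:: _; _] [:: _; _]) => //.
apply/arcsum_sums => //=; rewrite !word_of_profileK //.
exact: same_sums_pair.
Qed.

Lemma fibers_equiv_same_size (s t : seq W) :
  size s = size t -> arcsum s = arcsum t -> equiv K s t.
Proof.
move=> szst /(arcsum_sums szst) sums.
apply: (equiv_trans (equiv_representatives s)).
apply: equiv_trans (equiv_sym (equiv_representatives t)).
by apply: (connected profile_congruence) => // _ /mapP [w _ ->];
  apply: profile_of_word_valid.
Qed.

(** If the words have steps, the degree of the image gives the number of words.
    If they have none, every variable is sent to 1 and both monomials are
    equivalent to 1. *)
Lemma fibers_equiv (s t : seq W) : arcsum s = arcsum t -> equiv K s t.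
Proof.
have [N0|N0] := posnP N; last first.
  move=> st; apply: fibers_equiv_same_size => //.
  by have := congr1 mdeg st; rewrite !mdeg_arcsum /= => /eqP;
    rewrite eqn_pmul2r // => /eqP.
(* Without steps, x_w - 1 lies in the ideal. *)
have to_nil (r : seq W) : equiv K r [::].
  elim: r => [|w r IH]; first exact: equiv_refl.
  apply: equiv_trans IH; apply: (@equiv_small K _ _ [:: w] [::]) => //.
  apply/mnmP => k; apply/eqP; rewrite [arcsum [::]](_ : _ = 0%MM);
    last exact: big_nil.
  have /eqP : mdeg (arcsum [:: w]) = 0%N by rewrite mdeg_arcsum /= N0 muln0.
  by rewrite mdeg_eq0 => /eqP ->.
by move=> _; apply: equiv_trans (to_nil s) (equiv_sym (to_nil t)).
Qed.

Lemma generated_by_quadrics :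
  generates (bounded_degree (K := K) 2) (@markov_chain_ideal K 3 N.+1).
Proof.
move=> p; split; first exact: ideal_of_fibers fibers_equiv p.
case=> n [a [g [Gg ->]]]; rewrite /markov_chain_ideal Phi_sum big1 // => i _.
by rewrite PhiM (Gg i).1 mulr0.
Qed.

End Fibers.

(** * Degrees of generating sets *)

Section LowerBound.
Variables (K : fieldType) (T : nat).
Hypothesis T3 : (3 <= T)%N.
Notation W := (word 3 T).

(** At this point a variable has the value of a linear form, applied to its
    image: the sum of the coefficients of the constant monomial and of the
    images of a and b. The same holds for the monomial 1, since no variable is
    sent to 1. So an element of degree at most one of the ideal takes the value
    of that linear form at 0. *)
Lemma linear_eval (a b : W) (g : word_ring K 3 T) :
  markov_chain_ideal g -> (mpoly_degree g <= 1)%N ->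
  g.@[fun i => (arcs (enum_val i) == arcs a)%:R +
    (arcs (enum_val i) == arcs b)%:R] = 0.
Proof.
move=> g0 dg.
pose v (i : 'I_#|{: W}|) : K :=
  (arcs (enum_val i) == arcs a)%:R + (arcs (enum_val i) == arcs b)%:R.
rewrite -[meval _ _]/(g.@[v]).
have arcs0 w : (arcs (w : W) == 0%MM) = false.
  by rewrite -mdeg_eq0 mdeg_arcs; case: T T3 => [|[]].
have coefPhi k : \sum_(m <- msupp g) g@_m * (Phi ('X_[m] : word_ring K 3 T))@_k = 0.
  have := mcoeff0 K k; rewrite -[X in X@_k]g0 PhiE raddf_sum /= => h.
  by rewrite -[RHS]h; apply: eq_bigr => m _; rewrite Phi_X mcoeffZ.
have evX m : m \in msupp g -> ('X_[m] : word_ring K 3 T).@[v] =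
   (Phi ('X_[m] : word_ring K 3 T))@_0%MM +
     (Phi ('X_[m] : word_ring K 3 T))@_(arcs a)
   + (Phi ('X_[m] : word_ring K 3 T))@_(arcs b).
  move=> /msize_mdeg_lt lt_m; have {lt_m} : (mdeg m <= 1)%N.
    by move: dg lt_m; rewrite /mpoly_degree; case: (msize g) => //= n dn;
      rewrite ltnS => /leq_trans; apply.
  rewrite leq_eqVlt ltnS leqn0 mdeg_eq0 => /orP [/mdeg1P [i /eqP ->]|/eqP ->].
    have -> : ('X_i : word_ring K 3 T) = word_var K (enum_val i).
      by rewrite /word_var enum_valK.
    rewrite Phi_var !mcoeffX arcs0 add0r /word_var mevalXU /v enum_valK.
    by [].
  rewrite mpolyX0 rmorph1 /Phi rmorph1 !mcoeff1 eqxx !arcs0 !addr0 //.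
rewrite [g in LHS]mpolyE raddf_sum /= big_seq.
rewrite (eq_bigr (fun m => g@_m * (Phi ('X_[m] : word_ring K 3 T))@_0%MM
  + g@_m * (Phi ('X_[m] : word_ring K 3 T))@_(arcs a)
  + g@_m * (Phi ('X_[m] : word_ring K 3 T))@_(arcs b))) => [|m mg].
  by rewrite -big_seq !big_split /= !coefPhi !addr0.
by rewrite mevalZ evX // !mulrDr.
Qed.

(** The words u = 0 1 0 1 ... and v = 2 1 2 1 ... meet in their second letter.
    Exchanging what follows gives u' = 0 1 2 1 ... and v' = 2 1 0 1 ..., and
    u', using arcs of both u and v, has the image of neither. *)
Lemma generators_degree_gt1 G e :
  generates G (@markov_chain_ideal K 3 T) -> set_degree G e -> (2 <= e)%N.
Proof.
move=> genG [degG _]; rewrite ltnNge; apply/negP => e1.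
have v21 : v2 != v1 by []. have v01 : v0 != v1 by [].
(* Start at a, then alternate between state 1 and b. *)
pose swap (a b : 'I_3) n := if n is n'.+1 then alternate v1 b n' else a.
have swap_neq a b : a != v1 -> b != v1 -> forall n, swap a b n != swap a b n.+1.
  by move=> av bv [|n]; rewrite ?[swap _ _ 0]/a //; apply: alternate_neq;
    rewrite eq_sym.
have [u uE] := word_of_fun T (swap_neq v0 v0 v01 v01).
have [v vE] := word_of_fun T (swap_neq v2 v2 v21 v21).
have [u' uE'] := word_of_fun T (swap_neq v0 v2 v01 v21).
have [v' vE'] := word_of_fun T (swap_neq v2 v0 v21 v01).
have stepsE (w : W) a b i j : letters w = mkseq (swap a b) T :> seq _ ->
   steps (letters w) i j = (\sum_(k < T.-1) ((swap a b k == i) &&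
     (swap a b k.+1 == j)))%N.
  move=> ->; rewrite steps_sum size_mkseq; apply: eq_bigr => k _.
  by rewrite !nth_mkseq //; case: k => k /=; lia.
have uvE : arcsum [:: u; v] = arcsum [:: u'; v'].
  apply/arcsum_eq => i; rewrite !big_cons !big_nil !addn0.
  rewrite !(stepsE _ _ _ _ _ uE) !(stepsE _ _ _ _ _ vE).
  rewrite !(stepsE _ _ _ _ _ uE') !(stepsE _ _ _ _ _ vE') -!big_split /=.
  by split; apply: eq_bigr => -[[|k] ltk] _ //=; rewrite addnC.
pose q := monomial K [:: u; v] - monomial K [:: u'; v'].
have qI : markov_chain_ideal q.
  by rewrite /markov_chain_ideal /q PhiB !Phi_monomial uvE subrr.
have [n [a [g [Gg qE]]]] := (genG q).1 qI.
have gI i : markov_chain_ideal (g i) by apply/(genG _).2/ideal_gen.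
have g1 i : (mpoly_degree (g i) <= 1)%N by apply: leq_trans e1; apply: degG.
pose ev (i : 'I_#|{: W}|) : K :=
  (arcs (enum_val i) == arcs u)%:R + (arcs (enum_val i) == arcs v)%:R.
have : q.@[ev] = 0.
  rewrite qE rmorph_sum /= big1 // => i _.
  by rewrite rmorphM /= (linear_eval u v (gI i) (g1 i)) mulr0.
have [e01 [e010 e011]] := arc_word v01.
have v12 : v1 != v2 by []. have [e12 [e120 e121]] := arc_word v12.
have arcs_ne w w' e' : arcs (w : W) (enum_rank e') != arcs (w' : W) (enum_rank e')
  -> arcs w == arcs w' = false.
  by move=> h; apply: contraNF h => /eqP ->.
have T1 : T.-1 = (T - 3).+2 by lia.
have v_e01 : arcs v (enum_rank e01) = 0%N.
  rewrite arcsE e010 e011 (stepsE _ _ _ _ _ vE) big1 // => -[[|k] ltk] _ //=.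
  by rewrite /alternate /=; case: odd.
have u_e01 : (0 < arcs u (enum_rank e01))%N.
  by rewrite arcsE e010 e011 (stepsE _ _ _ _ _ uE) T1 big_ord_recl.
have u_e12 : arcs u (enum_rank e12) = 0%N.
  rewrite arcsE e120 e121 (stepsE _ _ _ _ _ uE) big1 // => -[[|k] ltk] _ //=.
  by rewrite /alternate /=; case: odd.
have u'_e01 : (0 < arcs u' (enum_rank e01))%N.
  by rewrite arcsE e010 e011 (stepsE _ _ _ _ _ uE') T1 big_ord_recl.
have u'_e12 : (0 < arcs u' (enum_rank e12))%N.
  by rewrite arcsE e120 e121 (stepsE _ _ _ _ _ uE') T1 !big_ord_recl.
rewrite /q rmorphB /monomial !big_cons !big_nil !mulr1 !rmorphM /= /word_var
  !mevalXU /ev !enum_rankK !eqxx.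
rewrite (arcs_ne u v e01) ?(arcs_ne v u e01) ?(arcs_ne u' v e01) ?(arcs_ne u' u
  e12);
  try by rewrite ?v_e01 ?u_e12 -?lt0n ?[_ == arcs _ _]eq_sym -?lt0n //.
rewrite !addr0 !add0r mulr1 mul0r subr0 => /eqP; rewrite oner_eq0.
by [].
Qed.
End LowerBound.

(** The maximal degree occurring among these generators; whether a degree
    occurs is decided classically. *)
Lemma bounded_degree_attained (K : fieldType) (T : nat) :
  exists2 e, (e <= 2)%N & set_degree (bounded_degree (K := K) (T := T) 2) e.
Proof.
have [[g g2 dg]|no2] := classic (exists2 g, bounded_degree (K := K) (T :=
  T) 2 g & mpoly_degree g = 2%N).
  by exists 2%N => //; split=> [h []|]; last by exists g.
have [[g g1 dg]|no1] := classic (exists2 g, bounded_degree (K := K) (T :=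
  T) 2 g & mpoly_degree g = 1%N).
  exists 1%N => //; split=> [h h2|]; last by exists g.
  by case E : (mpoly_degree h) (h2.2) => [|[|[|]]] // _; case: no2; exists h.
exists 0%N => //; split=> [h h2|].
  case E : (mpoly_degree h) (h2.2) => [|[|[|]]] // _; [case: no1 | case: no2];
    by exists h.
exists 0; last by rewrite /mpoly_degree mmeasure0.
by split; rewrite /mpoly_degree ?mmeasure0 // /markov_chain_ideal /Phi mmap0.
Qed.

Theorem theorem3p7 (K : fieldType) (T : nat) (hT : (0 < T)%N) :
  (exists2 d : nat,
     markov_degree (@markov_chain_ideal K 3 T) d & (d <= 2)%N) /\
  ((3 <= T)%N -> markov_degree (@markov_chain_ideal K 3 T) 2).
Proof.
case: T hT => // N _.
have gen := @generated_by_quadrics K N.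
have [e e2 dege] := bounded_degree_attained K N.+1.
pose P d := exists2 G, generates G (@markov_chain_ideal K 3 N.+1) & set_degree G d.
have Pe : P e by exists (bounded_degree (K := K) (T := N.+1) 2).
split.
  suff [d [d2 Pd min_d]] : exists d, [/\ (d <= 2)%N, P d & forall d', P d' ->
    (d <= d')%N].
    by exists d => //; split=> // G d' genG dG; apply: min_d; exists G.
  have [P0|n0] := classic (P 0%N); first by exists 0%N.
  have [P1|n1] := classic (P 1%N); first by exists 1%N; split=> // -[].
  exists 2%N; split=> // [|[|[|]] //].
  by case: e e2 Pe {dege} => [|[|[|]]].
move=> T3; split=> [|G d]; last exact: generators_degree_gt1.
have e_gt1 := generators_degree_gt1 T3 gen dege.
have E2 : e = 2%N by apply/eqP; rewrite eqn_leq e2.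
by rewrite E2 in Pe.
Qed.
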